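(* Let $\mathbb P$ be the $N$-point orthogonal polynomial ensemble with weight $w$ on the real line or on the unit circle, let $\theta$ be a measurable function on the real line, respectively the unit circle, with values in $[0,1]$, and let $\mathbf v$ be a finite configuration of points (defined up to the a.e. sense in which $\mathbb P^\theta_{|\mathbf v}$ is defined, namely for $m=\#\mathbf v$ with $\mathbb P^\theta(\xi_1(\Lambda)=m)>0$ and a.e. $\mathbf v$ with respect to the law of the mark $1$ points under $\mathbb P^\theta(\,\cdot\,|\,\xi_1(\Lambda)=m)$). If $n:=N-\#\mathbf v>0$, then the conditional ensemble $\mathbb P^\theta_{|\mathbf v}$ is the $n$-point orthogonal polynomial ensemble on the real line, respectively on the unit circle, with weight $w^\theta_{|\mathbf v}$, where $$w^\theta_{|\mathbf v}(x)=(1-\theta(x))\,w(x)\prod_{v\in\mathbf v}|x-v|^2$$ on the real line, and $$w^\theta_{|\mathbf v}(e^{it})=(1-\theta(e^{it}))\,w(e^{it})\prod_{v\in\mathbf v}|e^{it}-v|^2$$ on the unit circle.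
   Context: Orthogonal polynomial ensembles (OPEs). Real line: for a positive integer $N$ and a non-negative integrable weight $w$ on $\mathbb R$ all of whose moments $\int_{\mathbb R}x^kw(x)\,dx$ exist, the $N$-point OPE with weight $w$ is the point process of $N$ real points with joint probability distribution $\frac1{Z_N}\prod_{1\le i<j\le N}(x_j-x_i)^2\prod_{j=1}^Nw(x_j)\,dx_j$. Unit circle: for a non-negative integrable weight $w(e^{it})$, the $N$-point OPE is the point process of $N$ points $e^{it_1},\dots,e^{it_N}$ with joint probability distribution $\frac1{Z_N}\prod_{1\le j<k\le N}|e^{it_k}-e^{it_j}|^2\prod_{j=1}^Nw(e^{it_j})\,dt_j$, $t_j\in[0,2\pi)$. $Z_N$ are normalization constants. Let $\Lambda$ be $\mathbb R$ or the unit circle. Marked process: $\mathbb P^\theta$ is the point process on $\Lambda\times\{0,1\}$ obtained by giving each point $x$ of a configuration of $\mathbb P$, independently, mark $1$ with probability $\theta(x)$ and mark $0$ with probability $1-\theta(x)$; $\xi_b$ is the configuration (on $\Lambda$) of points with mark $b$. Reduced Palm measures: for a simple point process $\mathbb Q$ on $X$ with correlation functions $\rho_m$ with respect to a measure $\nu$, the $m$-th order reduced Palm measures $\{\mathbb Q_{\mathbf w}\}_{\mathbf w\in X^m}$ form a measurable family of point processes determined for $\rho_m\,d\nu^{\otimes m}$-a.e. $\mathbf w$ by $\mathbb E_{\mathbb Q}\sum\psi(\mathbf w;\xi-\delta_{\mathbf w})=\int_{X^m}\mathbb E_{\mathbb Q_{\mathbf w}}[\psi(\mathbf w;\xi)]\rho_m(\mathbf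 w)\,d\nu^{\otimes m}(\mathbf w)$ for all measurable $\psi\ge0$, the sum being over ordered $m$-tuples of distinct points of $\mathrm{supp}\,\xi$ and $\delta_{\mathbf w}=\sum_j\delta_{w_j}$. Conditional ensembles: for $m\ge0$ with $\mathbb P^\theta(\xi_1(\Lambda)=m)>0$ and $\mathbf v=\{v_1,\dots,v_m\}$, $\mathbb P^\theta_{|\mathbf v}$ is the $m$-th order reduced Palm measure of $\mathbb P^\theta(\,\cdot\,|\,\xi_1(\Lambda)=m)$ at $(v_1,1),\dots,(v_m,1)$, regarded as a point process on $\Lambda$ by omitting the marks $0$ (for $m=0$, the law of $\xi_0$ under $\mathbb P^\theta(\,\cdot\,|\,\xi_1(\Lambda)=0)$). In other words it represents the conditional law of $\xi_0$ given $\xi_1=\sum_j\delta_{v_j}$. *)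

(* Defs.v *)
From HB Require Import structures.
From mathcomp Require Import all_boot all_order all_algebra.
From mathcomp Require Import finmap multiset complex.
From mathcomp Require Import all_classical all_reals all_analysis.
From mathcomp Require Import measurable_realfun.
Set Implicit Arguments.
Unset Strict Implicit.
Unset Printing Implicit Defensive.
Import Order.TTheory GRing.Theory Num.Theory.
Import numFieldNormedType.Exports.
Local Open Scope classical_set_scope.
Local Open Scope ring_scope.

(* Every process here has finitely many points, so a configuration is a finite
   multiset; [seq_mset s] is the configuration sum_(x <- s) delta_x. *)
Definition finite_conf (T : choiceType) : Type := multiset T.
HB.instance Definition _ (T : choiceType) := Choice.on (finite_conf T).
HB.instance Definition _ (T : choiceType) :=
  isPointed.Build (finite_conf T) (@mset0 T).

Definition npoints (T : choiceType) (A : set T) (xi : finite_conf T) : nat :=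
  count (fun x => x \in A) (enum_mset xi).

Definition counting_sets d (T : measurableType d) : set (set (finite_conf T)) :=
  [set E | exists A (k : nat),
     measurable A /\ E = [set xi | npoints A xi = k]].

(* A point process on T is a probability measure on [conf T]. *)
Definition conf d (T : measurableType d) : Type :=
  g_sigma_algebraType (@counting_sets d T).
HB.instance Definition _ d (T : measurableType d) :=
  Measurable.on (conf T).

(* [tuple_integral nu n f] is the integral of the measurable f >= 0 against the
   n-fold product of the sigma-finite nu, written as an iterated integral. *)
Fixpoint tuple_integral d (T : measurableType d) (R : realType)
    (nu : set T -> \bar R) (n : nat) : (n.-tuple T -> \bar R) -> \bar R :=
  match n with
  | 0 => fun f => f [tuple]
  | k.+1 => fun f =>
      \int[nu]_x tuple_integral nu (fun t : k.-tuple T => f [tuple of x :: t])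
  end%E.

Section ensembles.
Context d (T : measurableType d) (R : realType).
Variables (nu : set T -> \bar R) (dist : T -> T -> R).
Local Open Scope ereal_scope.

Definition ope_density (n : nat) (w : T -> R) (x : n.-tuple T) : R :=
  ((\prod_(i < n) \prod_(j < n | (i < j)%N) dist (tnth x j) (tnth x i) ^+ 2) *
   \prod_(j < n) w (tnth x j))%R.

Definition ope_partition (n : nat) (w : T -> R) : \bar R :=
  tuple_integral nu (fun x : n.-tuple T => (ope_density w x)%:E).

Definition ope_law (n : nat) (w : T -> R) (P : set (conf T) -> \bar R) : Prop :=
  [/\ 0 < ope_partition n w, ope_partition n w < +oo &
    forall E : set (conf T), measurable E ->
      P E = (fine (ope_partition n w))^-1%:E *
        tuple_integral nu (fun x : n.-tuple T =>
          (ope_density w x * \1_E (seq_mset x : conf T))%:E)].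

Definition cond_weight (w theta : T -> R) (v : seq T) (x : T) : R :=
  ((1 - theta x) * w x * \prod_(y <- v) dist x y ^+ 2)%R.

End ensembles.

Section marking.
Context d (T : measurableType d) (R : realType).
Local Open Scope ereal_scope.

(* Law of the marked configuration when xi is marked independently; it does not
   depend on the order in which [enum_mset] lists the points of xi. *)
Definition mark_law (theta : T -> R) (xi : conf T)
    (E : set (conf (T * bool)%type)) : \bar R :=
  let s : seq T := enum_mset xi in
  (\sum_(b : (size s).-tuple bool)
     (\prod_(p <- zip s b) (if p.2 then theta p.1 else 1 - theta p.1)) *
     \1_E (seq_mset (zip s b) : conf (T * bool)%type))%R%:E.

Definition is_marking (theta : T -> R) (P : probability (conf T) R)
    (Ptheta : probability (conf (T * bool)%type) R) : Prop :=
  forall E, measurable E -> Ptheta E = \int[P]_xi mark_law theta xi E.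

Definition points_of_mark (b : bool) (xi : conf (T * bool)%type) : conf T :=
  seq_mset [seq p.1 | p <- enum_mset xi & p.2 == b].

Definition omit_marks (xi : conf (T * bool)%type) : conf T :=
  seq_mset [seq p.1 | p <- enum_mset xi].

Definition num_marked1 (m : nat) : set (conf (T * bool)%type) :=
  [set xi | npoints setT (points_of_mark true xi) = m].

Lemma measurable_num_marked1 m : measurable (num_marked1 m).
Proof.
rewrite (_ : num_marked1 m = [set xi | npoints (setT `*` [set true]) xi = m]).
  apply: sub_sigma_algebra; exists (setT `*` [set true]), m; split => //.
  exact: measurableX.
apply/seteqP; suff H (xi : conf (T * bool)%type) :
    npoints setT (points_of_mark true xi) = npoints (setT `*` [set true]) xi.
  by split => xi; rewrite /num_marked1 /= H.
rewrite /npoints /points_of_mark.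
rewrite (permP (perm_eq_seq_mset _)) count_map count_filter.
apply: eq_count => -[x b] /=.
rewrite in_setT; apply/idP/idP; rewrite in_setE => /=.
  by move/eqP => ->.
by case=> _ ->.
Qed.

Definition cond_num_marked1 (Q : probability (conf (T * bool)%type) R)
    (m : nat) : probability (conf (T * bool)%type) R :=
  mnormalize (mrestr Q (measurable_num_marked1 m)) Q.

End marking.

Section palm.
Context d (T : measurableType d) (R : realType).
Local Open Scope ereal_scope.

(* Ordered m-tuples of distinct points of supp xi; [msetB] is xi - delta_w. *)
Definition sum_distinct (m : nat) (psi : m.-tuple T -> conf T -> \bar R)
    (xi : conf T) : \bar R :=
  \sum_(w : m.-tuple (finsupp xi) | uniq w)
    psi (map_tuple val w) (msetB xi (seq_mset (map val w)) : conf T).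

Definition is_correlation (Q : probability (conf T) R) (nu : set T -> \bar R)
    (m : nat) (rho : m.-tuple T -> R) : Prop :=
  [/\ measurable_fun setT rho, forall w, (0 <= rho w)%R &
    forall phi : m.-tuple T -> \bar R,
      measurable_fun setT phi -> (forall w, 0 <= phi w) ->
      \int[Q]_xi sum_distinct (fun w _ => phi w) xi =
      tuple_integral nu (fun w => phi w * (rho w)%:E)].

Definition is_reduced_palm (Q : probability (conf T) R) (nu : set T -> \bar R)
    (m : nat) (rho : m.-tuple T -> R)
    (palm : R.-pker (m.-tuple T) ~> conf T) : Prop :=
  is_correlation Q nu rho /\
  forall psi : m.-tuple T * conf T -> \bar R,
    measurable_fun setT psi -> (forall p, 0 <= psi p) ->
    \int[Q]_xi sum_distinct (fun w eta => psi (w, eta)) xi =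
    tuple_integral nu (fun w =>
      (\int[palm w]_eta psi (w, eta)) * (rho w)%:E).

End palm.

Definition cond_ensemble d (T : measurableType d) (R : realType) (m : nat)
    (palm : R.-pker (m.-tuple (T * bool)%type) ~> conf (T * bool)%type)
    (v : m.-tuple T) : set (conf T) -> \bar R :=
  pushforward (palm (map_tuple (fun x => (x, true)) v)) (@omit_marks d T).

Definition line_weight (R : realType) (w : R -> R) : Prop :=
  [/\ measurable_fun setT w, forall x, 0 <= w x &
    forall k : nat, lebesgue_measure.-integrable setT
      (fun x => (x ^+ k * w x)%:E)].

Definition line_dist (R : realType) (x y : R) : R := `|x - y|.

Definition line_ope (R : realType) (n : nat) (w : R -> R)
    (P : set (conf R) -> \bar R) : Prop :=
  line_weight w /\ ope_law lebesgue_measure (@line_dist R) n w P.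

Record circle (R : realType) : Type :=
  Circle { cval : R[i]; _ : ComplexField.Normc.normc cval == 1 }.
HB.instance Definition _ (R : realType) := [isSub for @cval R].
HB.instance Definition _ (R : realType) := [Choice of circle R by <:].

Lemma normc_expi (R : realType) (t : R) :
  ComplexField.Normc.normc (Complex (cos t) (sin t)) == 1.
Proof. by rewrite /ComplexField.Normc.normc cos2Dsin2 sqrtr1. Qed.

Definition expi (R : realType) (t : R) : circle R := Circle (normc_expi t).
HB.instance Definition _ (R : realType) :=
  isPointed.Build (circle R) (expi 0).

Definition circle_coord (R : realType) (z : circle R) : R * R :=
  (complex.Re (cval z), complex.Im (cval z)).

(* The Borel sigma-algebra of the circle as a subspace of the plane. *)
HB.instance Definition _ (R : realType) :=
  Measurable.copy (circle R)
    (g_sigma_algebra_preimageType (@circle_coord R)).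

(* The image of dt on [0, 2 pi[ under t |-> e^(it). *)
Definition arc_measure (R : realType) : set (circle R) -> \bar R :=
  pushforward (mrestr lebesgue_measure
    (measurable_itv `[0, (2 * pi : R)[)) (@expi R).

Definition circle_dist (R : realType) (x y : circle R) : R :=
  ComplexField.Normc.normc (cval x - cval y).

Definition circle_weight (R : realType) (w : circle R -> R) : Prop :=
  [/\ measurable_fun setT w, forall z, 0 <= w z &
    lebesgue_measure.-integrable `[0, (2 * pi : R)[
      (fun t : R => (w (expi t))%:E)].

Definition circle_ope (R : realType) (n : nat) (w : circle R -> R)
    (P : set (conf (circle R)) -> \bar R) : Prop :=
  circle_weight w /\ ope_law (@arc_measure R) (@circle_dist R) n w P.

(* Main.v *)
Require Import Defs.
From HB Require Import structures.
From mathcomp Require Import all_boot all_order all_algebra.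
From mathcomp Require Import fingroup perm.
From mathcomp Require Import finmap multiset complex.
From mathcomp Require Import all_classical all_reals all_analysis.
From mathcomp Require Import measurable_realfun.
From mathcomp Require Import ring lra.
Set Implicit Arguments.
Unset Strict Implicit.
Unset Printing Implicit Defensive.
Import Order.TTheory GRing.Theory Num.Theory.
Import numFieldNormedType.Exports.
Local Open Scope classical_set_scope.
Local Open Scope ring_scope.

(** Label the points of the ensemble as x = (v, y) with v : T^m carrying the
    mark 1 and y : T^n carrying the mark 0, where m + n = N. The density of the
    labelled marked process with respect to mu^N is a constant times

      prod_(i < j) |x_i - x_j|^2 * prod_i w(x_i)
        * prod_(i <= m) theta(v_i) * prod_j (1 - theta(y_j)),

    and the Vandermonde product splits into the one of v, the one of y and the
    interaction prod_(i, j) |y_j - v_i|^2. Hence the density is C(v) times the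
    density of the n-point ensemble with weight
    (1 - theta) * w * prod_(z in v) |. - z|^2 ([ope_density_cat]). For fixed v
    the factor C(v) is a constant, which normalization removes, so the
    conditional law of y given v is the announced ensemble.

    Most of the work is to read this off the definition of Palm measures.

    Labelling. A process of N points is given by a symmetric density, but its
    law lives on multisets with the sigma-algebra of counting events. A set of
    multisets is measurable if and only if it is so in labelled coordinates
    ([measurable_conf_tuples]), so every functional of configurations can be
    handled as a symmetric function of tuples. Independent marking produces a sum
    over all sequences of N marks; by permutation invariance of mu^N
    ([integral_perm_tuple]) all sequences with m marks 1 contribute equally, and
    conditioning on m marks 1 leaves the single sequence 1^m 0^n
    ([cond_num_marked1_tuples]).

    Palm measures. Testing the Palm identity on phi(w) 1_E(eta) and the
    correlation identity on phi(w) Palm_w(E) gives two expectations that agree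
    ([palm_exchange]); neither involves the correlation function nor the
    reference measure any more. In labelled coordinates
    ([integral_sum_distinct]) this says that the section weights
    W_E(v) = int k(v, y) 1_E(y) dy of the labelled density k satisfy
    int_B W_E = int_B Palm_v(E) W(v) dv for all B, with W the weight of the
    full space, that is W_E = Palm_v(E) W for almost every v
    ([ae_palm_section]).

    One exceptional set. The events of configurations are generated by a
    countable pi-system ([measurable_cylinderE]), so one null set of tuples v
    serves all E. Since W is the density of the observed points, almost surely no
    labelling of the points of mark 1 is exceptional or has W(v) = 0
    ([ae_cond_ensemble]). *)

(** * Configurations in labelled coordinates *)

Section finite_index.
Context d (S : measurableType d).

(** Countably many outcomes of finitely many measurable tests: any condition on
    the outcomes is a countable union of finite intersections. *)
Lemma measurable_ffun_preimage (I : finType) (C : countType) (g : S -> I -> C)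
    (D : set {ffun I -> C}) :
  (forall i c, measurable [set s | g s i = c]) ->
  measurable [set s | D [ffun i => g s i]].
Proof.
move=> mg; rewrite (_ : mkset _ =
    \bigcup_(f : {ffun I -> C})
      (if f \in D then \bigcap_(i in [set: I]) [set s | g s i = f i] else set0)).
  apply: countable_bigcupT_measurable => // f; case: ifP => // _.
  by apply: fin_bigcap_measurable => // i _; exact: mg.
apply/seteqP; split => [s Ds|s [f _]].
  by exists [ffun i => g s i] => //; rewrite mem_set// => i _; rewrite ffunE.
case: ifPn => // /set_mem Df gf /=.
by rewrite (_ : [ffun i => g s i] = f)//; apply/ffunP => i; rewrite ffunE gf.
Qed.

Lemma measurable_bool_ffun_preimage (I : finType) (g : S -> I -> bool)
    (D : set {ffun I -> bool}) :
  (forall i, measurable [set s | g s i]) ->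
  measurable [set s | D [ffun i => g s i]].
Proof.
move=> mg; apply: measurable_ffun_preimage => i -[]; first exact: mg.
rewrite (_ : mkset _ = ~` [set s | g s i]); first exact/measurableC/mg.
by apply/seteqP; split => s /=; case: (g s i).
Qed.

Lemma measurable_fin_count (I : finType) (l : seq I) (g : S -> I -> bool) k :
  (forall i, measurable [set s | g s i]) ->
  measurable [set s | count (g s) l = k].
Proof.
move=> /(@measurable_bool_ffun_preimage _ _
  [set f : {ffun I -> bool} | count f l = k]).
by under eq_set do rewrite /= (eq_count (ffunE _)).
Qed.

End finite_index.

Section finite_counting.
Context d (S : measurableType d) (Y : Type) (I : finType).
Variables (D : set S) (y : S -> I -> Y).

Definition hits (A : set Y) (s : S) : nat := \sum_(i : I) (y s i \in A).

(** Only finitely many points are tested, so along an increasing sequence of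
    sets the number of hits is eventually constant; this is what makes the sets
    with measurable hit counts a Dynkin class. *)
Lemma lambda_system_hits : measurable D ->
  lambda_system setT
    [set A | forall k, measurable (D `&` [set s | hits A s = k])].
Proof.
move=> mD; split => //=.
- move=> k; apply: measurableI => //.
  have -> : [set s | hits setT s = k] = if #|I| == k then setT else set0.
    apply/seteqP; split => s; rewrite /= /hits.
      under eq_bigr do rewrite in_setT.
      by rewrite sum1_card => ->; rewrite eqxx.
    case: ifP => // /eqP <- _.
    under eq_bigr do rewrite in_setT.
    by rewrite sum1_card.
  by case: ifP.
- move=> A B BA mA mB k.
  rewrite (_ : _ `&` _ = \bigcup_j
      ((D `&` [set s | hits A s = k + j]%N) `&`
       (D `&` [set s | hits B s = j]))).
    by apply: bigcupT_measurable => j; apply: measurableI.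
  have hitsD s : (hits (A `\` B) s + hits B s = hits A s)%N.
    rewrite /hits -big_split; apply: eq_bigr => i _ /=.
    rewrite in_setD; have [yB|] := boolP (y s i \in B); last by rewrite addn0 andbT.
    by rewrite andbF add0n; move/set_mem/BA/mem_set : yB => ->.
  apply/seteqP; split => [s [Ds /= <-]|s [j _ [[Ds /= hA] [_ /= hB]]]].
    by exists (hits B s); rewrite // hitsD.
  by split => //=; move: (hitsD s); rewrite hA hB => /addIn.
- move=> F ndF mF k.
  rewrite (_ : _ `&` _ = \bigcup_p \bigcap_(q in [set q | (p <= q)%N])
      (D `&` [set s | hits (F q) s = k])).
    apply: bigcupT_measurable => p; apply: bigcap_measurable; first by exists p => /=.
    by move=> q _; exact: mF.
  have stable s : exists p, forall q, (p <= q)%N ->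
      hits (\bigcup_i F i) s = hits (F q) s.
    have /choice[p pP] : forall i : I, exists p, forall q, (p <= q)%N ->
        (y s i \in \bigcup_i F i) = (y s i \in F q).
      move=> i; have [/set_mem[p _ yp]|nF] := boolP (y s i \in \bigcup_i F i).
        exists p => q pq; rewrite mem_set//.
        by move/subsetPset : (ndF _ _ pq); exact.
      exists 0%N => q _; apply/esym/negbTE; apply: contra nF => /set_mem yq.
      by apply/mem_set; exists q.
    exists (\max_i p i)%N => q pq; apply: eq_bigr => i _; rewrite (pP i q)//.
    by apply: leq_trans pq; exact: leq_bigmax.
  apply/seteqP; split => [s [Ds <-]|s [p _ pF]].
    have [p pE] := stable s; exists p => // q /= pq; split => //=.
    by rewrite -pE.
  have [q qE] := stable s.
  have [Ds /=] := pF (maxn p q) (leq_maxl _ _).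
  by rewrite -qE ?leq_maxr.
Qed.

End finite_counting.

Section rectangles.
Context d (T : measurableType d) (n : nat).

Definition rectangle (A : 'I_n -> set T) : set (n.-tuple T) :=
  [set x | forall i, A i (tnth x i)].

Definition rectangles : set (set (n.-tuple T)) :=
  [set rectangle A | A in [set A | forall i, measurable (A i)]].

Lemma rectangles_setI : setI_closed rectangles.
Proof.
move=> _ _ [A mA <-] [B mB <-]; exists (fun i => A i `&` B i).
  by move=> i; apply: measurableI; [exact: mA|exact: mB].
apply/seteqP; split => [x AB|x [xA xB] i]; last by split.
by split => i; have [] := AB i.
Qed.

Lemma measurable_rectangle A : (forall i, measurable (A i)) ->
  measurable (rectangle A).
Proof.
move=> mA; rewrite (_ : rectangle A =
    \bigcap_(i in [set: 'I_n]) ((@tnth n T ^~ i) @^-1` A i)).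
  apply: fin_bigcap_measurable => // i _.
  by rewrite -[X in measurable X]setTI; apply: measurable_tnth.
by apply/seteqP; split => [x Ax i _|x Ax i]; exact: Ax.
Qed.

Lemma measurable_tupleE : @measurable _ (n.-tuple T) = <<s rectangles >>.
Proof.
apply/seteqP; split; last first.
  apply: smallest_sub; first exact: sigma_algebra_measurable.
  by move=> _ [A mA <-]; exact: measurable_rectangle.
apply: smallest_sub; first exact: smallest_sigma_algebra.
move=> B; rewrite -bigcup_seq => -[i _ [C mC <-]]; apply: sub_sigma_algebra.
exists (fun j => if j == i then C else setT).
  by move=> j; case: ifP.
apply/seteqP; split => [x /(_ i)|x [_ xC] j]; first by rewrite eqxx.
by case: eqP => [->|].
Qed.

End rectangles.

Section configurations.
Context d (T : measurableType d).

Lemma npoints_seq_mset (A : set T) s :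
  npoints A (seq_mset s) = count (fun x => x \in A) s.
Proof. by rewrite /npoints (seq.permP (perm_eq_seq_mset _)). Qed.

Lemma measurable_npoints (A : set T) k : measurable A ->
  measurable [set xi : conf T | npoints A xi = k].
Proof. by move=> mA; apply: sub_sigma_algebra; exists A, k. Qed.

Lemma measurable_fun_conf d' (S : measurableType d') (f : S -> conf T) :
  (forall A k, measurable A -> measurable [set s | npoints A (f s) = k]) ->
  measurable_fun setT f.
Proof.
move=> mf; apply: (@measurability _ _ S (conf T) setT f (@counting_sets d T)) => //.
by move=> _ [_ [A [k [mA ->]]] <-]; rewrite setTI; exact: mf.
Qed.

Lemma measurable_seq_mset_tnth n (l : seq 'I_n) :
  measurable_fun setT
    (fun x : n.-tuple T => seq_mset [seq tnth x i | i <- l] : conf T).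
Proof.
apply: measurable_fun_conf => A k mA.
under eq_set do rewrite npoints_seq_mset count_map.
apply: measurable_fin_count => i /=.
rewrite (_ : mkset _ = (@tnth n T ^~ i) @^-1` A).
  by rewrite -[X in measurable X]setTI; exact: measurable_tnth.
by apply/seteqP; split => x /=; rewrite in_setE.
Qed.

Lemma measurable_seq_mset n :
  measurable_fun setT (fun x : n.-tuple T => seq_mset x : conf T).
Proof.
rewrite (_ : (fun _ => _) = fun x : n.-tuple T =>
    seq_mset [seq tnth x i | i <- enum 'I_n]).
  exact: measurable_seq_mset_tnth.
by apply/funext => x; rewrite map_tnth_enum.
Qed.

Lemma seq_mset_perm (s t : seq T) : perm_eq s t -> seq_mset s = seq_mset t.
Proof. by move/eq_seq_msetP. Qed.

Lemma enum_seq_mset_perm (s : seq T) : perm_eq (enum_mset (seq_mset s)) s.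
Proof. exact: perm_eq_seq_mset. Qed.

Lemma npointsT (xi : conf T) : npoints setT xi = size (enum_mset xi).
Proof. by rewrite /npoints -count_predT; apply: eq_count => x; rewrite in_setT. Qed.

End configurations.

Section descent.
Context d (T : measurableType d).

(** The default value is never met on configurations of n points, for which the
    [reordering xi s] run over all labellings of xi. *)
Definition reordering n (xi : conf T) (s : 'S_n) : n.-tuple T :=
  [tuple nth point (enum_mset xi) (s i) | i < n].

Lemma perm_reordering n (xi : conf T) (s : 'S_n) :
  npoints setT xi = n -> perm_eq (reordering xi s) (enum_mset xi).
Proof.
rewrite npointsT => sz; rewrite /reordering.
have /eqP sz' := sz.
pose t := Tuple sz'.
have -> : enum_mset xi = t :> seq T by [].
rewrite perm_sym; apply/tuple_permP; exists (s^-1)%g.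
rewrite /=; apply: (@eq_from_nth _ point).
  by rewrite sz size_map size_enum_ord.
move=> i; rewrite sz => ilt.
rewrite (nth_map (Ordinal ilt)) ?size_enum_ord//.
have -> : nth (Ordinal ilt) (enum 'I_n) i = Ordinal ilt.
  by apply/val_inj => /=; rewrite nth_enum_ord.
by rewrite tnth_mktuple permKV.
Qed.

(** Rectangles generate, and for a rectangle the number of labellings that fall in
    it is a permanent, a function of finitely many counts of points. *)
Lemma measurable_reordering_hits n (B : set (n.-tuple T)) k : measurable B ->
  measurable ([set xi : conf T | npoints setT xi = n] `&`
              [set xi | hits (@reordering n) B xi = k]).
Proof.
move: k; pose H := [set B | forall k, measurable
  ([set xi : conf T | npoints setT xi = n] `&`
              [set xi | hits (@reordering n) B xi = k])].
move=> k mB; suff : B \in H by rewrite in_setE; exact.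
apply/mem_set; move: mB; rewrite measurable_tupleE; move: B.
have mD : measurable [set xi : conf T | npoints setT xi = n].
  exact: measurable_npoints.
apply: (lambda_system_subset (@rectangles_setI _ T n)
  (lambda_system_hits (@reordering n) mD)) => //.
move=> _ [A mA <-] {}k.
(* The permanent depends only on how many points have each membership pattern
   with respect to the sides of the rectangle. *)
pose pat (x : T) : {ffun 'I_n -> bool} := [ffun i => x \in A i].
pose occ (xi : conf T) (p : {ffun 'I_n -> bool}) : nat :=
  npoints [set x | pat x = p] xi.
have mocc p c : measurable [set xi : conf T | occ xi p = c].
  apply: measurable_npoints.
  have -> : [set x | pat x = p] = [set x | [set p] [ffun i => x \in A i]] by [].
  apply: measurable_bool_ffun_preimage => i.
  by under eq_set do rewrite in_setE; exact: mA.
pose good xi := npoints setT xi = n /\ hits (@reordering n) (rectangle A) xi = k.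
pose E := [set f | exists2 xi, good xi & f = [ffun p => occ xi p]].
rewrite (_ : _ `&` _ = [set xi | E [ffun p => occ xi p]]).
  exact: measurable_ffun_preimage.
apply/seteqP; split => [xi xigood|xi [xi' [nxi' hxi'] occE]].
  by exists xi.
have patE : perm_eq [seq pat x | x <- enum_mset xi]
                    [seq pat x | x <- enum_mset xi'].
  apply/allP => p _ /=; apply/eqP.
  move/ffunP : occE => /(_ p); rewrite !ffunE /occ /npoints => occp.
  rewrite !count_map.
  have eqp (s : seq T) : count (preim pat (pred1 p)) s =
      count (fun x => x \in [set x | pat x = p]) s.
    apply: eq_count => x /=; apply/idP/idP; rewrite in_setE.
      by move/eqP.
    by move=> /= ->.
  by rewrite !eqp.
have nxi : npoints setT xi = n.
  rewrite npointsT -(size_map pat) (perm_size patE) size_map.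
  by rewrite -npointsT.
split => //=; rewrite -hxi'.
have szp : size [seq pat x | x <- enum_mset xi'] == n.
  by rewrite size_map -npointsT nxi'.
have /tuple_permP[u uE] : perm_eq [seq pat x | x <- enum_mset xi] (Tuple szp) by [].
rewrite /hits [RHS](reindex_inj (mulIg u)) /=; apply: eq_bigr => s _; congr nat_of_bool.
have key xi1 (s1 : 'S_n) : npoints setT xi1 = n ->
    (reordering xi1 s1 \in rectangle A) =
    [forall i, nth [ffun=> false] [seq pat x | x <- enum_mset xi1] (s1 i) i].
  move=> nxi1; apply/idP/forallP => [/set_mem rA i|rA].
    rewrite (nth_map point) -?npointsT ?nxi1//.
    by rewrite ffunE; apply/mem_set; have := rA i; rewrite tnth_mktuple.
  apply/mem_set => i; have := rA i.
  rewrite (nth_map point) -?npointsT ?nxi1//.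
  by rewrite ffunE => /set_mem; rewrite tnth_mktuple.
rewrite !key// uE; apply: eq_forallb => i; rewrite permM.
rewrite (nth_map (s i)) ?size_enum_ord// nth_ord_enum.
by rewrite (tnth_nth [ffun=> false]).
Qed.

(** An event E of n-point configurations is recovered from its labelled version B
    as the set of configurations all of whose n! labellings hit B; hence
    measurability may be tested in labelled coordinates. *)
Lemma measurable_conf_tuples (E : set (conf T)) :
  (forall n, measurable [set x : n.-tuple T | E (seq_mset x)]) ->
  measurable E.
Proof.
move=> mE; rewrite (_ : E = \bigcup_n
    ([set xi : conf T | npoints setT xi = n] `&`
     [set xi | hits (@reordering n) [set x | E (seq_mset x)] xi = #|{: 'S_n}|])).
  by apply: bigcupT_measurable => n; exact: measurable_reordering_hits.
have Eord n (xi : conf T) (s : 'S_n) : npoints setT xi = n ->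
    (reordering xi s \in [set x : n.-tuple T | E (seq_mset x)]) = (xi \in E).
  move=> nxi; rewrite /in_mem /= /in_set /=; congr (asbool (E _)).
  by rewrite (seq_mset_perm (perm_reordering s nxi)) seq_mset_id.
apply/seteqP; split => [xi Exi|xi [n _ [/= nxi]]].
  exists (npoints setT xi) => //; split => //=.
  rewrite /hits (eq_bigr (fun=> 1%N)) ?sum1_card// => s _.
  by rewrite Eord// mem_set.
rewrite /hits (eq_bigr (fun=> (xi \in E) : nat)) => [|s _]; last by rewrite Eord.
have [/set_mem//|_] := boolP (xi \in E).
by rewrite big1// => /esym/eqP; rewrite -[#|_|]/#|'S_n| card_Sn -leqn0 leqNgt fact_gt0.
Qed.

Lemma measurable_fun_conf_tuples d' (X : measurableType d') (f : conf T -> X) :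
  (forall n, measurable_fun setT (fun x : n.-tuple T => f (seq_mset x))) ->
  measurable_fun setT f.
Proof.
move=> mf _ A mA; rewrite setTI; apply: measurable_conf_tuples => n.
by rewrite -[X in measurable X]setTI; exact: mf.
Qed.

End descent.

(** * A countable pi-system of events of configurations *)

Section countable_generation.
Context d (T : measurableType d) (G : nat -> set T).
Hypothesis genG : @measurable _ T = <<s range G >>.

Definition cell (F : seq nat) : set T := [set x | all (fun i => x \in G i) F].

(** The cylinders over the finite intersections of a countable generating family
    form a countable pi-system of events of configurations. *)
Definition cylinder (l : seq (seq nat * nat)) : set (conf T) :=
  [set xi | all (fun p => npoints (cell p.1) xi == p.2) l].

Lemma cell_cat F F' : cell F `&` cell F' = cell (F ++ F').
Proof.
apply/seteqP; split => x; rewrite /cell /= all_cat; first by move=> [-> ->].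
by move/andP.
Qed.

Lemma cylinder_cat l l' : cylinder l `&` cylinder l' = cylinder (l ++ l').
Proof.
apply/seteqP; split => x; rewrite /cylinder /= all_cat; first by move=> [-> ->].
by move/andP.
Qed.

Lemma cell_nil : cell [::] = setT.
Proof. by apply/seteqP. Qed.

Lemma cylinder_nil : cylinder [::] = setT.
Proof. by apply/seteqP. Qed.

Lemma measurable_cell F : measurable (cell F).
Proof.
elim: F => [|i F IH]; first by rewrite cell_nil.
rewrite -cat1s -cell_cat; apply: measurableI => //.
rewrite (_ : cell _ = G i); first by rewrite genG; apply: sub_sigma_algebra; exists i.
by apply/seteqP; split => x; rewrite /cell /= andbT in_setE.
Qed.

Lemma cylinder1 F k : cylinder [:: (F, k)] = [set xi | npoints (cell F) xi = k].
Proof. by apply/seteqP; split => x; rewrite /cylinder /= andbT => /eqP ->. Qed.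

Lemma measurable_cylinder l : measurable (cylinder l).
Proof.
elim: l => [|[F k] l IH]; first by rewrite cylinder_nil.
rewrite -cat1s -cylinder_cat; apply: measurableI => //.
by rewrite cylinder1; apply: measurable_npoints; exact: measurable_cell.
Qed.

Lemma measurable_cellE : @measurable _ T = <<s range cell >>.
Proof.
apply/seteqP; split; last first.
  apply: smallest_sub; first exact: sigma_algebra_measurable.
  by move=> _ [F _ <-]; exact: measurable_cell.
rewrite genG; apply: smallest_sub; first exact: smallest_sigma_algebra.
move=> _ [i _ <-]; apply: sub_sigma_algebra; exists [:: i] => //.
by apply/seteqP; split => x; rewrite /cell /= andbT in_setE.
Qed.

Let S := g_sigma_algebraType (range cylinder).

Let y n (xi : S) (i : 'I_n) := nth point (enum_mset (xi : finite_conf T)) i.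

Let hits_nth n (A : set T) (xi : S) : npoints setT (xi : finite_conf T) = n ->
  hits (@y n) A xi = npoints A (xi : finite_conf T).
Proof.
move=> nxi; rewrite /hits /npoints -sum1_count.
rewrite (big_nth point) big_mkord.
have -> : size (enum_mset xi) = n by rewrite -nxi -(npointsT (xi : conf T)).
by rewrite [RHS]big_mkcond; apply: eq_bigr => i _; case: (_ \in _).
Qed.

(** For fixed k, the sets A for which the event that A holds k points is generated
    by the cylinders form a Dynkin class containing the pi-system of cells. The
    argument is run on n-point configurations, where counting points in A amounts
    to n tests. *)
Lemma measurable_cylinderE : @measurable _ (conf T) = <<s range cylinder >>.
Proof.
apply/seteqP; split; last first.
  apply: smallest_sub; first exact: sigma_algebra_measurable.
  by move=> _ [l _ <-]; exact: measurable_cylinder.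
apply: smallest_sub; first exact: smallest_sigma_algebra.
move=> _ [A [k [mA ->]]].
pose D n : set S := [set xi | npoints setT (xi : finite_conf T) = n].
have mcell F j : measurable ([set xi | npoints (cell F) xi = j] : set S).
  by rewrite -cylinder1; apply: sub_sigma_algebra; exists [:: (F, j)].
have mD n : measurable (D n) by rewrite /D -cell_nil; exact: mcell.
suff hA n : measurable (D n `&` [set xi | hits (@y n) A xi = k]).
  have -> : [set xi | npoints A xi = k] =
      \bigcup_n (D n `&` [set xi | hits (@y n) A xi = k]).
    apply/seteqP; split => [xi xiA|xi [n _ [/= nxi]]].
      by exists (npoints setT xi) => //; split => //=; rewrite hits_nth.
    by rewrite /= hits_nth.
  exact: (@bigcupT_measurable _ S).
move: k; suff : A \in [set A | forall k, measurable
    (D n `&` [set xi | hits (@y n) A xi = k])] by rewrite in_setE.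
apply/mem_set; move: mA; rewrite measurable_cellE; move: A.
have IG : setI_closed (range cell).
  by move=> _ _ [F _ <-] [F' _ <-]; exists (F ++ F') => //; rewrite cell_cat.
apply: (lambda_system_subset IG (lambda_system_hits (@y n) (mD n))) => //.
move=> _ [F _ <-] k.
rewrite (_ : _ `&` _ = D n `&` ([set xi | npoints (cell F) xi = k] : set S)).
  exact: (@measurableI _ S).
by apply/seteqP; split => xi [nxi] /= h; split => //=; move: h; rewrite hits_nth.
Qed.

(** The reason for a countable pi-system: an identity between laws on
    configurations follows from countably many identities, each of which may fail
    on a null set of parameters. *)
Lemma eq_measure_conf (R : realType) (m1 m2 : {measure set (conf T) -> \bar R}) :
  (m1 setT < +oo)%E -> (forall l, m1 (cylinder l) = m2 (cylinder l)) ->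
  forall E, measurable E -> m1 E = m2 E.
Proof.
move=> m1oo m12; apply: (measure_unique (range cylinder) (fun=> setT)) => //.
- exact: measurable_cylinderE.
- by move=> _ _ [l _ <-] [l' _ <-]; exists (l ++ l') => //; rewrite cylinder_cat.
- by move=> _; exists [::] => //; rewrite cylinder_nil.
- by rewrite bigcup_const.
- by move=> _ [l _ <-].
Qed.

End countable_generation.

(** * Product measures on tuples *)

Section tuple_permutations.
Context (T : Type) (n : nat).

Definition perm_tuple (s : 'S_n) (x : n.-tuple T) : n.-tuple T :=
  [tuple tnth x (s i) | i < n].

Lemma perm_tupleK (s : 'S_n) : cancel (perm_tuple s) (perm_tuple s^-1%g).
Proof. by move=> x; apply: eq_from_tnth => i; rewrite !tnth_mktuple permKV. Qed.

End tuple_permutations.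

Lemma perm_perm_tuple (T : eqType) n (s : 'S_n) (x : n.-tuple T) :
  perm_eq (perm_tuple s x) x.
Proof. by apply/tuple_permP; exists s. Qed.

Lemma perm_tupleP (T : eqType) n (t x : n.-tuple T) :
  perm_eq t x -> exists s, t = perm_tuple s x.
Proof. by move/tuple_permP => [s ts]; exists s; apply/val_inj. Qed.

Lemma tnth_zip (S T : Type) n (x : n.-tuple S) (y : n.-tuple T) i :
  tnth [tuple of zip x y] i = (tnth x i, tnth y i).
Proof.
rewrite (tnth_nth (tnth x i, tnth y i)) /= nth_zip ?size_tuple//.
by rewrite -!tnth_nth.
Qed.

Lemma zip_perm_tuple (S T : Type) n (s : 'S_n) (x : n.-tuple S) (y : n.-tuple T) :
  [tuple of zip (perm_tuple s x) (perm_tuple s y)] =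
  perm_tuple s [tuple of zip x y].
Proof. by apply: eq_from_tnth => i; rewrite tnth_zip !tnth_mktuple tnth_zip. Qed.

Section indicators.
Local Open Scope ereal_scope.

Lemma measurable_EFin_indic d (T : measurableType d) (R : realType) (A : set T) :
  measurable A -> measurable_fun setT (fun x => (\1_A x : R)%:E).
Proof. by move=> mA; apply/measurable_EFinP; exact: measurable_indic. Qed.

Lemma prode_lty (R : realType) (I : Type) (s : seq I) (f : I -> \bar R) :
  (forall i, 0 <= f i) -> (forall i, f i < +oo) ->
  \big[mule/1]_(i <- s) f i < +oo.
Proof.
move=> f0 foo; suff : \big[mule/1]_(i <- s) f i \is a fin_num.
  by rewrite ge0_fin_numE// prode_ge0.
elim/big_ind : _ => // [x y xfin yfin|i _]; first exact: fin_numM.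
by rewrite ge0_fin_numE.
Qed.

End indicators.

Section tuple_measure.
Context d (T : measurableType d) (R : realType).
Variable mu : {sigma_finite_measure set T -> \bar R}.
Local Open Scope ereal_scope.

Let consp n (p : T * n.-tuple T) : n.+1.-tuple T := [tuple of p.1 :: p.2].

Let measurable_consp n : measurable_fun setT (@consp n).
Proof. exact: measurable_cons. Qed.

(** By Tonelli's theorem the iterated integral is the integral against an honest
    sigma-finite measure, so that the theory of integration applies to it. *)
Lemma tuple_measure_exists n :
  exists M : {sigma_finite_measure set (n.-tuple T) -> \bar R},
    forall f, measurable_fun setT f -> (forall x, 0 <= f x) ->
      \int[M]_x f x = tuple_integral mu f.
Proof.
elim: n => [|n [M ME]].
  exists (dirac [tuple]) => f mf f0 /=.
  by rewrite integral_dirac// diracT mul1e.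
have sfin : sigma_finite setT (pushforward (mu \x M) (@consp n)).
  have /sigma_finiteP[F [TF ndF Foo]] := sigma_finiteT mu.
  have /sigma_finiteP[G [TG ndG Goo]] := sigma_finiteT M.
  exists (fun i => [set t | F i (thead t) /\ G i [tuple of behead t]]).
    apply/seteqP; split => // t _.
    have : setT (thead t) by [].
    have : setT [tuple of behead t] by [].
    rewrite TF {1}TG => -[j _ Gj] [i _ Fi]; exists (maxn i j) => //; split.
    - by move: Fi; exact/subsetPset/ndF/leq_maxl.
    - by move: Gj; exact/subsetPset/ndG/leq_maxr.
  move=> i; have [mF Fi] := Foo i; have [mG Gi] := Goo i; split.
    apply: measurableI.
    - by rewrite -[X in measurable X]setTI; exact: measurable_tnth.
    - by rewrite -[X in measurable X]setTI; exact: measurable_behead.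
  rewrite /pushforward (_ : _ @^-1` _ = F i `*` G i).
    by rewrite product_measure1E// lte_mul_pinfty// ge0_fin_numE.
  apply/seteqP; split => -[x t] [/=]; rewrite /consp theadE /= => h.
    by move=> h'; split => //=; move: h'; congr (G i _); apply/val_inj.
  by move=> h'; split => //=; move: h'; congr (G i _); apply/val_inj.
pose m0 : {measure set (n.+1.-tuple T) -> \bar R} :=
  measure_function_pushforward__canonical__measure_function_Measure
    (mu \x M) (@measurable_consp n).
pose H2 := isSFinite.Build _ _ _ _ (@sfinite_measure_sigma_finite _ _ _ m0 sfin).
pose H3 := isSigmaFinite.Build _ _ _ (Measure.sort m0) sfin.
pose m1 : {sigma_finite_measure set (n.+1.-tuple T) -> \bar R} :=
  HB.pack_for (SigmaFiniteMeasure.type (n.+1.-tuple T) R) (Measure.sort m0) H2 H3.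
exists m1 => f mf f0.
rewrite (ge0_integral_pushforward (@measurable_consp n))//.
rewrite preimage_setT fubini_tonelli1;
  [|exact: (measurableT_comp mf (@measurable_consp n))|by move=> p; exact: f0].
apply: eq_integral => x _; rewrite /fubini_F/= ME//.
apply: (measurableT_comp mf); apply: measurable_cons.
  exact: measurable_cst.
exact: measurable_id.
Qed.

Definition tuple_measure n : {sigma_finite_measure set (n.-tuple T) -> \bar R} :=
  sval (cid (tuple_measure_exists n)).

Lemma tuple_integralE n f : measurable_fun setT f -> (forall x, 0 <= f x) ->
  tuple_integral mu f = \int[tuple_measure n]_x f x.
Proof. by rewrite /tuple_measure; case: cid => M /= ME mf f0; rewrite ME. Qed.

Lemma tuple_integral_cat m n (f : (m + n).-tuple T -> \bar R) :
  tuple_integral mu f = tuple_integral mu (fun v : m.-tuple T =>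
    tuple_integral mu (fun y : n.-tuple T => f [tuple of v ++ y])).
Proof.
elim: m f => [|m IH] f /=.
  by congr tuple_integral; apply/funext => y; congr f; apply/val_inj.
apply: eq_integral => x _; rewrite IH; congr tuple_integral; apply/funext => v.
by congr tuple_integral; apply/funext => y; congr f; apply/val_inj.
Qed.

Lemma tuple_integral_rectangle n (A : 'I_n -> set T) :
  (forall i, measurable (A i)) ->
  tuple_integral mu (fun x => (\1_(rectangle A) x)%:E) =
  \big[mule/1]_(i < n) mu (A i).
Proof.
elim: n A => [|n IH] A mA /=.
  by rewrite big_ord0 indicE mem_set// => -[].
transitivity (\int[mu]_x ((\1_(A ord0) x)%:E *
    \big[mule/1]_(i < n) mu (A (lift ord0 i)))).
  apply: eq_integral => x _; rewrite -IH; last by move=> i; exact: mA.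
  have [xA|xA] := boolP (x \in A ord0); last first.
    rewrite indicE (negbTE xA) mul0e (_ : (fun _ => _) = cst 0).
      by rewrite tuple_integralE// integral0.
    apply/funext => t /=; rewrite indicE memNset// => /(_ ord0) /=.
    by move/mem_set; rewrite (negbTE xA).
  rewrite indicE xA mul1e; congr tuple_integral; apply/funext => t; congr (_%:E).
  rewrite !indicE; congr (_%:R); congr nat_of_bool.
  apply/idP/idP => /set_mem rt; apply/mem_set => i.
    by have := rt (lift ord0 i); rewrite tnthS.
  have [<-|/unlift_some[j -> _]] := eqVneq ord0 i; first exact/set_mem.
  by rewrite tnthS; exact: rt.
rewrite ge0_integralZr//; last 2 first.
- by apply: measurable_EFin_indic; exact: mA.
- exact: prode_ge0.
by rewrite integral_indic// setIT big_ord_recl.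
Qed.

Lemma tuple_measure_rectangle n (A : 'I_n -> set T) :
  (forall i, measurable (A i)) ->
  tuple_measure n (rectangle A) = \big[mule/1]_(i < n) mu (A i).
Proof.
move=> mA; rewrite -tuple_integral_rectangle// tuple_integralE//.
  by rewrite integral_indic ?setIT//; exact: measurable_rectangle.
by apply: measurable_EFin_indic; exact: measurable_rectangle.
Qed.

Lemma measurable_perm_tuple n (s : 'S_n) : 
  measurable_fun setT (perm_tuple s : n.-tuple T -> n.-tuple T).
Proof.
apply/measurable_fun_tnthP => i.
rewrite (_ : _ \o _ = @tnth n T ^~ (s i)); first exact: measurable_tnth.
by apply/funext => x /=; rewrite tnth_mktuple.
Qed.

(** A permutation of the coordinates preserves the measure of rectangles, which
    determine the sigma-finite product measure. *)
Lemma integral_perm_tuple n (s : 'S_n) f :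
  measurable_fun setT f -> (forall x, 0 <= f x) ->
  \int[tuple_measure n]_x f (perm_tuple s x) = \int[tuple_measure n]_x f x.
Proof.
move=> mf f0; have ms := measurable_perm_tuple s.
pose m1 : {measure set (n.-tuple T) -> \bar R} :=
  measure_function_pushforward__canonical__measure_function_Measure
    (tuple_measure n) ms.
have := @ge0_integral_pushforward _ _ _ _ R _ ms (tuple_measure n) setT f
  measurableT mf.
rewrite preimage_setT => <-; last by move=> x _; exact: f0.
apply: (@eq_measure_integral _ _ _ _ _ m1) => A mA _.
have /sigma_finiteP[F [TF ndF Foo]] := sigma_finiteT mu.
apply: (measure_unique (@rectangles _ T n) (fun k => rectangle (fun=> F k))) => //.
- exact: measurable_tupleE.
- exact: rectangles_setI.
- by move=> k; exists (fun=> F k) => // i; exact: (Foo k).1.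
- apply/seteqP; split => // x _.
  have /choice[p pP] : forall i, exists p, F p (tnth x i).
    move=> i; have : setT (tnth x i) by [].
    by rewrite {1}TF => -[p _ Fp]; exists p.
  exists (\max_i p i)%N => // i; move: (pP i); apply/subsetPset/ndF.
  exact: leq_bigmax.
- move=> _ [B mB <-]; rewrite /m1 /= /pushforward.
  rewrite (_ : _ @^-1` _ = rectangle (fun i => B (s^-1%g i))).
    by rewrite !tuple_measure_rectangle//; rewrite [LHS](reindex_perm s)/=;
      under eq_bigr do rewrite permK.
  apply/seteqP; split => x rx i.
    by have := rx (s^-1%g i); rewrite tnth_mktuple permKV.
  by rewrite tnth_mktuple -[X in B X](permK s); exact: rx.
- move=> k; rewrite /m1 /= /pushforward.
  rewrite (_ : _ @^-1` _ = rectangle (fun=> F k)).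
    rewrite tuple_measure_rectangle; last by move=> i; exact: (Foo k).1.
    by apply: prode_lty => // i; exact: (Foo k).2.
  apply/seteqP; split => x rx i; last by rewrite tnth_mktuple; exact: rx.
  by have := rx (s^-1%g i); rewrite tnth_mktuple permKV.
Qed.

End tuple_measure.

(** * Images of weighted measures *)

Section weighted_image.
Context d1 d2 (X : measurableType d1) (Y : measurableType d2) (R : realType).
Variables (mu : {measure set Y -> \bar R}) (k : Y -> R) (s : Y -> X).
Hypotheses (mk : measurable_fun setT k) (k0 : forall y, 0 <= k y)
  (ms : measurable_fun setT s).
Local Open Scope ereal_scope.
Import HBNNSimple.

Let measurable_weight (h : X -> R) : measurable_fun setT h ->
  measurable_fun setT (fun y => (k y * h (s y))%:E).
Proof.
move=> mh; apply/measurable_EFinP; apply: measurable_funM => //.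
exact: measurableT_comp.
Qed.

Lemma weighted_image_measure : exists M : {measure set X -> \bar R},
  forall E, M E = \int[mu]_y (k y * \1_E (s y))%:E.
Proof.
pose M (E : set X) := \int[mu]_y (k y * \1_E (s y))%:E.
have ME E : M E = \int[mu]_(y in s @^-1` E) (k y)%:E.
  rewrite /M [RHS]integral_mkcond; apply: eq_integral => y _.
  rewrite /patch indicE; have -> : (y \in s @^-1` E) = (s y \in E) by [].
  by case: (_ \in E); rewrite ?mulr1 ?mulr0.
have M0 : M set0 = 0.
  by rewrite /M integral0_eq// => y _; rewrite indic0 mulr0.
have Mge0 E : 0 <= M E.
  by apply: integral_ge0 => y _; rewrite lee_fin mulr_ge0.
have Msigma : semi_sigma_additive M.
  move=> F mF tF mUF.
  rewrite [X in _ --> X](_ : _ = \sum_(n <oo) M (F n)).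
    apply/cvg_closeP; split; last by rewrite closeE.
    by apply: is_cvg_nneseries => n _ _; exact: Mge0.
  rewrite ME preimage_bigcup ge0_integral_bigcup//.
  - by apply: eq_eseriesr => n _; rewrite ME.
  - by move=> n; rewrite -[X in measurable X]setTI; exact: ms.
  - by apply: measurable_funTS; exact/measurable_EFinP.
  - by move=> y _; rewrite lee_fin.
  - apply/trivIsetP => i j _ _ ij; rewrite -preimage_setI.
    by move/trivIsetP : tF => /(_ _ _ Logic.I Logic.I ij) ->; rewrite preimage_set0.
pose H := isMeasure.Build _ _ _ M M0 Mge0 Msigma.
by exists (HB.pack_for (Measure.type X R) M H).
Qed.

(** Simple functions and monotone convergence carry a formula known for events
    over to nonnegative functions; this is how laws given by densities are used. *)
Lemma integral_weighted_image (P : {measure set X -> \bar R}) :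
  (forall E, measurable E -> P E = \int[mu]_y (k y * \1_E (s y))%:E) ->
  forall H, measurable_fun setT H -> (forall x, 0 <= H x) ->
  \int[P]_x H x = \int[mu]_y ((k y)%:E * H (s y)).
Proof.
move=> PE H mH H0; pose h := nnsfun_approx measurableT mH.
have hH x : EFin \o h^~ x @ \oo --> H x by exact: cvg_nnsfun_approx.
have h_nd x : {homo (h^~ x) : m n / (m <= n)%N >-> (m <= n)%R}.
  by move=> m n mn; exact/lefP/nd_nnsfun_approx.
have P_simple (g : {nnsfun X >-> R}) :
    \int[P]_x (g x)%:E = \int[mu]_y (k y * g (s y))%:E.
  have mg r : measurable (g @^-1` [set r]) by [].
  under eq_integral do rewrite fimfunE -fsumEFin//.
  rewrite ge0_integral_fsum//; last 2 first.
  - by move=> r; apply/measurable_EFinP; apply: measurable_funM.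
  - by move=> r x _; rewrite nnfun_muleindic_ge0.
  transitivity (\sum_(r \in range g)
      \int[mu]_y (r * (k y * \1_(g @^-1` [set r]) (s y)))%:E).
    apply: eq_fsbigr => r /set_mem [x _ <-].
    rewrite integralZl_indic_nnsfun// integral_indic// setIT PE//.
    under [in RHS]eq_integral do rewrite EFinM.
    rewrite ge0_integralZl//.
    - by apply: measurable_weight; exact: measurable_indic.
    - by move=> y _; rewrite lee_fin mulr_ge0.
    - by rewrite lee_fin.
  rewrite -ge0_integral_fsum//.
  - apply: eq_integral => y _; rewrite fsumEFin//; congr EFin.
    rewrite [in RHS]fimfunE [in RHS]mulrC mulr_fsuml//.
    by apply: eq_fsbigr => r _; rewrite mulrCA mulrC.
  - move=> r; apply/measurable_EFinP; apply: measurable_funM => //.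
    by apply/measurable_EFinP; apply: measurable_weight; exact: measurable_indic.
  - move=> r y _; rewrite mulrCA EFinM mule_ge0// ?lee_fin//.
    exact: nnfun_muleindic_ge0.
transitivity (limn (fun n => \int[P]_x (h n x)%:E)).
  rewrite -monotone_convergence//.
  - by apply: eq_integral => x _; apply/esym/cvg_lim => //; exact: hH.
  - by move=> n; exact/measurable_EFinP.
  - by move=> n x _; rewrite lee_fin.
  - by move=> x _ m n mn; rewrite lee_fin h_nd.
under eq_fun do rewrite P_simple.
rewrite -monotone_convergence//.
- apply: eq_integral => y _; apply/cvg_lim => //.
  under eq_fun do rewrite EFinM.
  by apply: cvgeZl => //; exact: hH.
- by move=> n; exact: measurable_weight.
- by move=> n y _; rewrite lee_fin mulr_ge0.
- by move=> y _ m n mn; rewrite lee_fin ler_wpM2l// h_nd.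
Qed.

End weighted_image.

(** * Marks and distinct points *)

Section marks.
Context (T : eqType) (V : nmodType) (F : seq (T * bool) -> V).
Hypothesis F_perm : forall s t, perm_eq s t -> F s = F t.

(** Listing the points in another order permutes the sequences of marks. *)
Lemma sum_marks_perm n (x : n.-tuple T) (s : seq T) : perm_eq s x ->
  \sum_(b : (size s).-tuple bool) F (zip s b) =
  \sum_(b : n.-tuple bool) F (zip x b).
Proof.
suff gen k (t : k.-tuple T) : perm_eq t x ->
    \sum_(b : k.-tuple bool) F (zip t b) =
    \sum_(b : n.-tuple bool) F (zip x b).
  exact: (gen _ (in_tuple s)).
move=> tx; have kn : k = n by rewrite -(size_tuple t) (perm_size tx) size_tuple.
subst k; have [p ->] := perm_tupleP tx.
rewrite (reindex_inj (can_inj (perm_tupleK p))) /=; apply: eq_bigr => b _.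
apply: F_perm; have /(congr1 val)/= -> := zip_perm_tuple p x b.
exact: (perm_perm_tuple p [tuple of zip x b]).
Qed.

End marks.

Section mark_law_tuple.
Context d (T : measurableType d) (R : realType) (theta : T -> R).

Definition mark_weight (s : seq (T * bool)) : R :=
  \prod_(p <- s) (if p.2 then theta p.1 else 1 - theta p.1).

Lemma mark_law_seq_mset n (x : n.-tuple T) E :
  mark_law theta (seq_mset x) E =
  (\sum_(b : n.-tuple bool)
     mark_weight (zip x b) * \1_E (seq_mset (zip x b) : conf (T * bool)%type))%:E.
Proof.
rewrite /mark_law -(@sum_marks_perm _ _ (fun s => mark_weight s *
  \1_E (seq_mset s : conf (T * bool)%type)) _ _ _ (enum_mset (seq_mset x)))//.
  move=> s t st; rewrite (seq_mset_perm st); congr (_ * _).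
  exact: perm_big.
exact: enum_seq_mset_perm.
Qed.

End mark_law_tuple.

Section distinct_points.
Context d (T : measurableType d) (R : realType) (m k : nat).

(** A list z may repeat points while the sum over distinct points sees each of
    them once; the first occurrences select one index per point. *)
Definition first_occurrence (z : k.-tuple T) (j : 'I_k) : bool :=
  index (tnth z j) z == j.

Definition unselected (i : m.-tuple 'I_k) : seq 'I_k :=
  [seq j <- enum 'I_k | j \notin i].

Lemma perm_unselected (i : m.-tuple 'I_k) : uniq i ->
  perm_eq (i ++ unselected i) (enum 'I_k).
Proof.
move=> ui; apply: uniq_perm; last first.
- by move=> j; rewrite mem_cat mem_filter mem_enum andbT; case: (j \in i).
- exact: enum_uniq.
- rewrite cat_uniq ui filter_uniq ?enum_uniq// andbT.
  by apply/hasPn => j; rewrite mem_filter => /andP[].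
Qed.

Lemma msetB_unselected (z : k.-tuple T) (i : m.-tuple 'I_k) : uniq i ->
  msetB (seq_mset z) (seq_mset [seq tnth z j | j <- i]) =
  seq_mset [seq tnth z j | j <- unselected i].
Proof.
move=> ui; apply/msetP => a; rewrite msetE2 !mset_seqE.
have /seq.permP/(_ (preim (tnth z) (pred1 a))) := perm_unselected ui.
rewrite count_cat -!count_map map_tnth_enum => <-.
by rewrite addKn.
Qed.

(** Expresses the sum over distinct points by indices that do not depend on the
    configuration, which gives access to measurability and to integration term by
    term. *)
Lemma sum_distinct_seq_mset (psi : m.-tuple T -> conf T -> \bar R) (z : k.-tuple T) :
  sum_distinct psi (seq_mset z) =
  (\sum_(i : m.-tuple 'I_k | uniq i && all (first_occurrence z) i)
    psi (map_tuple (tnth z) i)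
        (seq_mset [seq tnth z j | j <- unselected i] : conf T))%E.
Proof.
rewrite /sum_distinct; pose X := finsupp (seq_mset z).
have zX j : tnth z j \in X.
  by rewrite /X msuppE in_mset mset_seqE -has_count has_pred1 mem_tnth.
have Xz (p : X) : (index (val p) z < k)%N.
  rewrite -[X in (_ < X)%N](size_tuple z) index_mem.
  by have := valP p; rewrite /X msuppE in_mset mset_seqE -has_count has_pred1.
pose q j : X := [` zX j]%fset.
pose e p : 'I_k := Ordinal (Xz p).
have qe : cancel e q.
  move=> p; apply/val_inj => /=; rewrite (tnth_nth (val p)) /= nth_index//.
  by rewrite -index_mem size_tuple; exact: Xz.
have firstE j : first_occurrence z j = (e (q j) == j) by rewrite -val_eqE.
rewrite (reindex_onto (map_tuple q) (map_tuple e)) /=; last first.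
  by move=> w _; apply/val_inj => /=; rewrite mapK.
apply: eq_big => [i|i].
  have -> : (map_tuple e (map_tuple q i) == i) = all (first_occurrence z) i.
    rewrite -val_eqE /= -map_comp; apply/eqP/allP => [eqi j ji|fi].
      rewrite firstE; move/eqP : eqi; rewrite -{2}[val i]map_id.
      by move/eqP/eq_in_map/(_ j ji) => /= ->.
    by rewrite -[RHS]map_id; apply/eq_in_map => j /fi; rewrite firstE => /eqP.
  rewrite [in LHS]andbC [in RHS]andbC; case: allP => //= fi.
  apply: map_inj_in_uniq => j j' /fi + /fi.
  by rewrite !firstE => /eqP {2}<- /eqP {2}<- ->.
move=> /andP[qi /eqP eqi].
have ui : uniq i by rewrite -eqi /= map_inj_uniq//; exact: can_inj qe.
rewrite -msetB_unselected//; congr (psi _ (msetB _ (seq_mset _))).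
  by apply/val_inj; rewrite /= -map_comp.
by rewrite /= -map_comp.
Qed.

End distinct_points.

Section tuple_functions.
Context d d' (S : measurableType d) (T : measurableType d').

Lemma measurable_map_tnth m k (i : m.-tuple 'I_k) :
  measurable_fun setT (fun z : k.-tuple T => map_tuple (tnth z) i).
Proof.
apply/measurable_fun_tnthP => j.
rewrite (_ : _ \o _ = @tnth k T ^~ (tnth i j)); first exact: measurable_tnth.
by apply/funext => z /=; rewrite tnth_map.
Qed.

Lemma measurable_map_tuple m (f : S -> T) : measurable_fun setT f ->
  measurable_fun setT (fun x : m.-tuple S => map_tuple f x).
Proof.
move=> mf; apply/measurable_fun_tnthP => j.
rewrite (_ : _ \o _ = f \o @tnth m S ^~ j).
  by apply: measurableT_comp => //; exact: measurable_tnth.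
by apply/funext => z /=; rewrite tnth_map.
Qed.

Lemma measurable_zip_tuple p (b : p.-tuple S) :
  measurable_fun setT (fun x : p.-tuple T => [tuple of zip x b]).
Proof.
apply/measurable_fun_tnthP => i.
rewrite (_ : _ \o _ = fun x => (tnth x i, tnth b i)).
  by apply: measurable_fun_pair => //; exact: measurable_tnth.
by apply/funext => x /=; rewrite tnth_zip.
Qed.

Lemma measurable_cat_tuple m n :
  measurable_fun setT (fun p : m.-tuple T * n.-tuple T => [tuple of p.1 ++ p.2]).
Proof.
apply/measurable_fun_tnthP => j; have [i ->|i ->] := split_ordP j.
  rewrite (_ : _ \o _ = (@tnth m T ^~ i) \o fst).
    by apply: measurableT_comp => //; exact: measurable_tnth.
  by apply/funext => -[v y] /=; rewrite tnth_lshift.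
rewrite (_ : _ \o _ = (@tnth n T ^~ i) \o snd).
  by apply: measurableT_comp => //; exact: measurable_tnth.
by apply/funext => -[v y] /=; rewrite tnth_rshift.
Qed.

End tuple_functions.

Section measurable_sum_distinct.
Context d (T : measurableType d) (R : realType).
Hypothesis diagT : measurable [set p : T * T | p.1 = p.2].
Local Open Scope ereal_scope.

Lemma measurable_first_occurrence k (j : 'I_k) :
  measurable [set z : k.-tuple T | first_occurrence z j].
Proof.
have mij (i : 'I_k) : measurable [set z : k.-tuple T | tnth z i = tnth z j].
  rewrite (_ : mkset _ =
    (fun z : k.-tuple T => (tnth z i, tnth z j)) @^-1` [set p | p.1 = p.2])//.
  rewrite -[X in measurable X]setTI.
  have : measurable_fun setT (fun z : k.-tuple T => (tnth z i, tnth z j)).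
    by apply: measurable_fun_pair; exact: measurable_tnth.
  exact.
rewrite (_ : mkset _ = \bigcap_(i in [set i : 'I_k | (i < j)%N])
    ~` [set z | tnth z i = tnth z j]).
  by apply: fin_bigcap_measurable => // i _; exact: measurableC.
have le_index (z : k.-tuple T) (i : 'I_k) : (index (tnth z i) z <= i)%N.
  rewrite leqNgt; apply/negP => /(before_find (tnth z i)) /=.
  by rewrite -tnth_nth eqxx.
apply/seteqP; split => [z /eqP zj i /= ij zij|z zj].
  by move: (le_index z i); rewrite zij zj leqNgt ij.
rewrite /= /first_occurrence eqn_leq le_index /= leqNgt; apply/negP => lt.
have zjz : tnth z j \in val z by exact: mem_tnth.
have ik : (index (tnth z j) z < k)%N by exact: ltn_trans lt _.
apply: (zj (Ordinal ik) lt) => /=.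
by rewrite (tnth_nth (tnth z j)) /= nth_index.
Qed.

Lemma measurable_sum_distinct m (psi : m.-tuple T * conf T -> \bar R) :
  measurable_fun setT psi ->
  measurable_fun setT (sum_distinct (fun w eta => psi (w, eta))).
Proof.
move=> mpsi; apply: measurable_fun_conf_tuples => k.
under eq_fun do rewrite sum_distinct_seq_mset big_mkcond.
apply: emeasurable_sum => i.
rewrite (_ : (fun _ => _) = fun z : k.-tuple T =>
    if uniq i && all (first_occurrence z) i then
      psi (map_tuple (tnth z) i,
           seq_mset [seq tnth z j | j <- unselected i] : conf T) else 0)//.
apply: measurable_fun_ifT.
- apply: (measurable_fun_bool true) => //; rewrite setTI.
  have -> : (fun z : k.-tuple T =>
        uniq i && all (first_occurrence z) i) @^-1` [set true] =
      if uniq i then \bigcap_(j in [set j | j \in i])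
        [set z : k.-tuple T | first_occurrence z j] else set0.
    apply/seteqP; split => z /=; case: (uniq i) => //=.
      by move/allP => zi j /= /zi.
    by move=> zi; apply/allP => j ji; exact: zi.
  case: ifP => // _; apply: fin_bigcap_measurable => // j _.
  exact: measurable_first_occurrence.
- apply: (measurableT_comp mpsi); apply: measurable_fun_pair.
    exact: measurable_map_tnth.
  exact: measurable_seq_mset_tnth.
- exact: measurable_cst.
Qed.

End measurable_sum_distinct.

Section marked_configurations.
Context d (T : measurableType d).

Lemma diagonal_pair_bool : measurable [set p : T * T | p.1 = p.2] ->
  measurable [set p : (T * bool) * (T * bool) | p.1 = p.2].
Proof.
move=> diagT.
have mp : measurable_fun setT (fun p : (T * bool) * (T * bool) => (p.1.1, p.2.1)).
  apply: measurable_fun_pair.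
    exact: (measurableT_comp measurable_fst measurable_fst).
  exact: (measurableT_comp measurable_fst measurable_snd).
have mb (b : bool) :
    measurable [set p : (T * bool) * (T * bool) | p.1.2 = b /\ p.2.2 = b].
  apply: measurableI.
    have /(_ measurableT [set b]) := measurableT_comp (@measurable_snd _ _ T bool)
      (@measurable_fst _ _ (T * bool)%type (T * bool)%type).
    by rewrite setTI; exact.
  have /(_ measurableT [set b]) := measurableT_comp (@measurable_snd _ _ T bool)
    (@measurable_snd _ _ (T * bool)%type (T * bool)%type).
  by rewrite setTI; exact.
rewrite (_ : mkset _ =
   ((fun p : (T * bool) * (T * bool) => (p.1.1, p.2.1)) @^-1` [set p | p.1 = p.2]) `&`
   \bigcup_(b in [set: bool]) [set p | p.1.2 = b /\ p.2.2 = b]).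
  apply: measurableI; first by rewrite -[X in measurable X]setTI; exact: mp.
  by apply: fin_bigcup_measurable => // b _; exact: mb.
apply/seteqP; split => -[[x a] [y b]] /=.
  by case=> -> ->; split => //; exists b.
by move=> [-> [c _ [/= -> ->]]].
Qed.

Lemma npoints_points_of_mark b (A : set T) (xi : conf (T * bool)%type) :
  npoints A (points_of_mark b xi) = npoints (A `*` [set b]) xi.
Proof.
rewrite /points_of_mark npoints_seq_mset count_map count_filter /npoints.
apply: eq_count => -[x c] /=; apply/andP/idP => [[/set_mem xA /eqP cb]|].
  by apply/mem_set.
by move=> /set_mem [/= xA ->]; split => //; exact/mem_set.
Qed.

Lemma measurable_points_of_mark b :
  measurable_fun setT (@points_of_mark d T b).
Proof.
apply: measurable_fun_conf => A k mA.
under eq_set do rewrite npoints_points_of_mark.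
by apply: measurable_npoints; exact: measurableX.
Qed.

Lemma measurable_omit_marks : measurable_fun setT (@omit_marks d T).
Proof.
apply: measurable_fun_conf => A k mA.
have npE xi : npoints A (@omit_marks d T xi) = npoints (A `*` setT) xi.
  rewrite /omit_marks npoints_seq_mset count_map; apply: eq_count => -[x c] /=.
  by apply/idP/idP => /set_mem; rewrite ?in_setE //= => -[].
under eq_set do rewrite npE.
by apply: measurable_npoints; exact: measurableX.
Qed.

Lemma points_of_mark_seq_mset b (s : seq (T * bool)) :
  points_of_mark b (seq_mset s) = seq_mset [seq p.1 | p <- s & p.2 == b].
Proof.
apply: seq_mset_perm; apply: perm_map; apply: perm_filter.
exact: enum_seq_mset_perm.
Qed.

Lemma omit_marks_seq_mset (s : seq (T * bool)) :
  omit_marks (seq_mset s) = seq_mset [seq p.1 | p <- s].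
Proof. by apply: seq_mset_perm; apply: perm_map; exact: enum_seq_mset_perm. Qed.

End marked_configurations.

(** * Sums over distinct points under a labelled density *)

Lemma sume_const (R : realType) (I : finType) (P : pred I) (a : \bar R) :
  (0 <= a -> \sum_(i | P i) a = #|P|%:R%:E * a)%E.
Proof.
move=> a0; rewrite (eq_bigr (fun=> 1%:E * a)%E) => [|i _]; last by rewrite mul1e.
by rewrite -ge0_sume_distrl// sumEFin sumr_const.
Qed.

Definition mark_all (T : Type) p (b : bool) (v : p.-tuple T) : p.-tuple (T * bool) :=
  map_tuple (fun x => (x, b)) v.

Definition leading_marks m n : (m + n).-tuple bool :=
  [tuple of nseq m true ++ nseq n false].

Lemma tnth_leading_marks m n j : tnth (leading_marks m n) j = (j < m)%N.
Proof.
rewrite (tnth_nth false) /= nth_cat size_nseq !nth_nseq.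
by case: ltnP => //; case: ifP.
Qed.

Lemma zip_leading_marks (T : Type) m n (v : m.-tuple T) (y : n.-tuple T) :
  zip [tuple of v ++ y] (leading_marks m n) = mark_all true v ++ mark_all false y.
Proof.
have zip_nseq p b (t : p.-tuple T) : zip t (nseq p b) = [seq (x, b) | x <- t].
  by case: t => t /= /eqP <-; elim: t => //= x t ->.
by rewrite /= zip_cat ?size_tuple ?size_nseq// !zip_nseq.
Qed.

Section selections.
Variables m n : nat.
Local Notation N := (m + n)%N.

Definition head_tuple (T : Type) (x : N.-tuple T) : m.-tuple T :=
  [tuple tnth x (lshift n i) | i < m].

Definition tail_tuple (T : Type) (x : N.-tuple T) : n.-tuple T :=
  [tuple tnth x (rshift m i) | i < n].

Lemma head_tail_tuple (T : Type) (x : N.-tuple T) :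
  x = [tuple of head_tuple x ++ tail_tuple x].
Proof.
apply: eq_from_tnth => j; have [i ->|i ->] := split_ordP j.
  by rewrite tnth_lshift tnth_mktuple.
by rewrite tnth_rshift tnth_mktuple.
Qed.

Lemma head_tuple_cat (T : Type) (v : m.-tuple T) (y : n.-tuple T) :
  head_tuple [tuple of v ++ y] = v.
Proof. by apply: eq_from_tnth => j; rewrite tnth_mktuple tnth_lshift. Qed.

Lemma tail_tuple_cat (T : Type) (v : m.-tuple T) (y : n.-tuple T) :
  tail_tuple [tuple of v ++ y] = y.
Proof. by apply: eq_from_tnth => j; rewrite tnth_mktuple tnth_rshift. Qed.

Definition leading_selection (i : m.-tuple 'I_N) : bool :=
  uniq i && all (fun j : 'I_N => (j < m)%N) i.

Lemma leading_selection_exists : exists i, leading_selection i.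
Proof.
exists [tuple lshift n j | j < m]; apply/andP; split.
  by rewrite map_inj_uniq ?enum_uniq//; exact: lshift_inj.
by apply/allP => _ /mapP[j _ ->] /=.
Qed.

(** Selecting all the leading indices in some order, and listing the remaining
    ones after them, permutes the indices without mixing the two marks. *)
Lemma leading_selection_perm (i : m.-tuple 'I_N) : leading_selection i ->
  exists s : 'S_N, perm_tuple s (leading_marks m n) = leading_marks m n /\
    forall (T : Type) (x : N.-tuple T),
      map_tuple (tnth [tuple of zip x (leading_marks m n)]) i =
        mark_all true (head_tuple (perm_tuple s x)) /\
      [seq tnth [tuple of zip x (leading_marks m n)] j | j <- unselected i] =
        mark_all false (tail_tuple (perm_tuple s x)).
Proof.
move=> /andP[ui /allP im]; have iu := perm_unselected ui.
have szi : size (i ++ unselected i) == N by rewrite (perm_size iu) size_enum_ord.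
pose t := Tuple szi.
have [s ts] : exists s, t = perm_tuple s (ord_tuple N).
  apply: perm_tupleP.
  by rewrite /= -[X in perm_eq _ X]/(val (ord_tuple N)) val_ord_tuple.
have permE (U : Type) (x : N.-tuple U) :
    val (perm_tuple s x) = [seq tnth x j | j <- i ++ unselected i].
  rewrite -[i ++ _]/(val t) ts /= -map_comp; apply: eq_map => j /=.
  by rewrite tnth_ord_tuple.
have bits_i : [seq tnth (leading_marks m n) j | j <- i] = nseq m true.
  rewrite -[m in RHS](size_tuple i) -(size_map (tnth (leading_marks m n)) i).
  apply/all_pred1P; rewrite all_map; apply/allP => j ji /=.
  by rewrite tnth_leading_marks im.
have bits_u : [seq tnth (leading_marks m n) j | j <- unselected i] = nseq n false.
  have := perm_map (tnth (leading_marks m n)) iu.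
  rewrite map_cat bits_i map_tnth_enum /= perm_cat2l => pu.
  rewrite -[n in RHS](size_nseq n false) -(perm_size pu).
  by apply/all_pred1P; rewrite (perm_all _ pu); apply/all_pred1P; rewrite size_nseq.
exists s; split.
  by apply/val_inj; rewrite permE map_cat bits_i bits_u.
move=> T x.
have szh : size (head_tuple (perm_tuple s x)) = size [seq tnth x j | j <- i].
  by rewrite size_tuple size_map size_tuple.
have := permE _ x.
rewrite {1}[perm_tuple s x]head_tail_tuple map_cat /=.
move=> /(congr1 (fun l => (take (size [seq tnth x j | j <- i]) l,
                          drop (size [seq tnth x j | j <- i]) l))).
rewrite take_size_cat// drop_size_cat// take_size_cat// drop_size_cat//.
move=> [headE tailE].
have bitE b (l : seq 'I_N) :
    all (pred1 b) [seq tnth (leading_marks m n) j | j <- l] ->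
    [seq tnth [tuple of zip x (leading_marks m n)] j | j <- l] =
    [seq (y, b) | y <- [seq tnth x j | j <- l]].
  rewrite all_map -map_comp => /allP lb; apply/eq_in_map => j /lb /= /eqP <-.
  by rewrite tnth_zip.
split.
  apply/val_inj; rewrite /= headE (bitE true)//.
  by rewrite bits_i; apply/all_pred1P; rewrite size_nseq.
rewrite /= tailE (bitE false)//.
by rewrite bits_u; apply/all_pred1P; rewrite size_nseq.
Qed.

End selections.
(** The labelled density k of the marked process Q is taken relative to the marks
    1^m 0^n; it is only required to be invariant under the permutations that
    respect these marks, and to vanish where two coordinates coincide. *)
Section leading_marked.
Context d (T : measurableType d) (R : realType) (m n : nat).
Variable mu : {sigma_finite_measure set T -> \bar R}.
Variable k : (m + n).-tuple T -> R.
Hypotheses (mk : measurable_fun setT k) (k0 : forall x, 0 <= k x).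
Hypothesis k_perm : forall x x' : (m + n).-tuple T,
  perm_eq (zip x (leading_marks m n)) (zip x' (leading_marks m n)) -> k x = k x'.
Hypothesis k_uniq : forall x, k x != 0 -> uniq x.
Variable Q : probability (conf (T * bool)%type) R.
Local Open Scope ereal_scope.

Let N := (m + n)%N.
Let bits := leading_marks m n.
Let marked (x : N.-tuple T) : conf (T * bool)%type := seq_mset (zip x bits).

Hypothesis QE : forall E, measurable E ->
  Q E = \int[tuple_measure mu N]_x (k x * \1_E (marked x))%:E.
Hypothesis diagT : measurable [set p : T * T | p.1 = p.2].

Let measurable_marked : measurable_fun setT marked.
Proof.
apply: (measurableT_comp (@measurable_seq_mset _ (T * bool)%type N)).
exact: measurable_zip_tuple.
Qed.

Lemma integral_leading_marked H : measurable_fun setT H -> (forall xi, 0 <= H xi) ->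
  \int[Q]_xi H xi = \int[tuple_measure mu N]_x ((k x)%:E * H (marked x)).
Proof. by move=> mH H0; apply: integral_weighted_image. Qed.

Lemma integral_tuple_cat (f : N.-tuple T -> \bar R) :
  measurable_fun setT f -> (forall x, 0 <= f x) ->
  \int[tuple_measure mu N]_x f x =
  \int[tuple_measure mu m]_v \int[tuple_measure mu n]_y f [tuple of v ++ y].
Proof.
move=> mf f0.
have mcat : measurable_fun setT
    (fun p : m.-tuple T * n.-tuple T => f [tuple of p.1 ++ p.2]).
  exact: (measurableT_comp mf (@measurable_cat_tuple _ T m n)).
rewrite -tuple_integralE// tuple_integral_cat.
under [X in tuple_integral _ X]eq_fun => v.
  rewrite tuple_integralE//.
  over.
  apply: (measurableT_comp mf).
  exact: (measurableT_comp (@measurable_cat_tuple _ T m n) (pair1_measurable v)).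
rewrite tuple_integralE//.
- exact: (measurable_fun_fubini_tonelli_F _ mcat).
- by move=> v; apply: integral_ge0.
Qed.

(** Among the ordered choices of m distinct points carrying the mark 1, all give
    the same contribution, because permuting the coordinates changes neither
    [mu^(m+n)] nor the weight; coordinates that coincide have weight 0. *)
Lemma integral_sum_distinct
    (psi : m.-tuple (T * bool) * conf (T * bool)%type -> \bar R) :
  measurable_fun setT psi -> (forall p, 0 <= psi p) ->
  (forall (w : m.-tuple (T * bool)) eta, ~~ all snd w -> psi (w, eta) = 0) ->
  \int[Q]_xi sum_distinct (fun w eta => psi (w, eta)) xi =
  #|[pred i | @leading_selection m n i]|%:R%:E *
  \int[tuple_measure mu m]_v \int[tuple_measure mu n]_y
    ((k [tuple of v ++ y])%:E * psi (mark_all true v, seq_mset (mark_all false y))).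
Proof.
move=> mpsi psi0 psi_marks.
have diagTb := diagonal_pair_bool diagT.
have msum := measurable_sum_distinct diagTb mpsi.
rewrite integral_leading_marked//; last first.
  by move=> xi; rewrite /sum_distinct; apply: sume_ge0 => w _; exact: psi0.
pose Psi (x : N.-tuple T) := (k x)%:E *
  psi (mark_all true (head_tuple x), seq_mset (mark_all false (tail_tuple x))).
have mPsi : measurable_fun setT Psi.
  apply: emeasurable_funM; first exact/measurable_EFinP.
  apply: (measurableT_comp mpsi); apply: measurable_fun_pair.
    apply: (measurableT_comp
      (@measurable_map_tuple _ _ T (T * bool)%type m (pair^~ true) _)).
      exact: measurable_fun_pair.
    apply/measurable_fun_tnthP => j; rewrite (_ : _ \o _ = @tnth _ T ^~ (lshift n j)).
      exact: measurable_tnth.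
    by apply/funext => x /=; rewrite tnth_mktuple.
  apply: (measurableT_comp (@measurable_seq_mset _ (T * bool)%type n)).
  apply: (measurableT_comp
    (@measurable_map_tuple _ _ T (T * bool)%type n (pair^~ false) _)).
    exact: measurable_fun_pair.
  apply/measurable_fun_tnthP => j; rewrite (_ : _ \o _ = @tnth _ T ^~ (rshift m j)).
    exact: measurable_tnth.
  by apply/funext => x /=; rewrite tnth_mktuple.
have Psi0 x : 0 <= Psi x by rewrite /Psi mule_ge0// lee_fin.
(* Where k does not vanish all points differ, so every index is a first
   occurrence; and psi only sees selections of indices marked 1. *)
have kE (i : m.-tuple 'I_N) (x : N.-tuple T) :
    (k x)%:E * (if uniq i && all (first_occurrence [tuple of zip x bits]) i then
       psi (map_tuple (tnth [tuple of zip x bits]) i,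
         seq_mset [seq tnth [tuple of zip x bits] j | j <- unselected i]) else 0) =
    if leading_selection i then
      (k x)%:E * psi (map_tuple (tnth [tuple of zip x bits]) i,
         seq_mset [seq tnth [tuple of zip x bits] j | j <- unselected i]) else 0.
  have [kx|kx] := eqVneq (k x) 0%R; first by rewrite kx !mul0e if_same.
  have ux := k_uniq kx.
  have uz : uniq (zip x bits).
    by apply: (@map_uniq _ _ fst); rewrite -/unzip1 unzip1_zip ?size_tuple.
  have first_all : all (first_occurrence [tuple of zip x bits]) i.
    apply/allP => j _; rewrite /first_occurrence.
    rewrite (tnth_nth (tnth [tuple of zip x bits] j)).
    by rewrite index_uniq//= size_zip !size_tuple minnn.
  rewrite first_all andbT /leading_selection.
  case: (uniq i) => /=; last by rewrite mule0.
  case: ifPn => // nlead; rewrite psi_marks ?mule0//.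
  apply: contra nlead => /allP sel; apply/allP => j ji.
  have := sel (tnth [tuple of zip x bits] j).
  rewrite /= map_f// => /(_ isT).
  by rewrite tnth_zip /= tnth_leading_marks.
have termE (i : m.-tuple 'I_N) : leading_selection i -> exists s : 'S_N,
    forall x, (k x)%:E * psi (map_tuple (tnth [tuple of zip x bits]) i,
         seq_mset [seq tnth [tuple of zip x bits] j | j <- unselected i])
    = Psi (perm_tuple s x).
  move=> li; have [s [sbits sx]] := leading_selection_perm li.
  exists s => x; have [-> ->] := sx T x.
  rewrite /Psi (k_perm (x := x) (x' := perm_tuple s x))//.
  have -> : zip (perm_tuple s x) (leading_marks m n) =
      val (perm_tuple s [tuple of zip x (leading_marks m n)]).
    by rewrite -zip_perm_tuple sbits.
  by rewrite perm_sym; exact: perm_perm_tuple.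
pose term i x := if leading_selection i then
  (k x)%:E * psi (map_tuple (tnth [tuple of zip x bits]) i,
    seq_mset [seq tnth [tuple of zip x bits] j | j <- unselected i]) else 0.
have termP (i : m.-tuple 'I_N) : exists s : 'S_N, forall x,
    term i x = if leading_selection i then Psi (perm_tuple s x) else 0.
  rewrite /term; have [/termE[s sE]|_] := boolP (leading_selection i).
    by exists s.
  by exists 1%g.
have mperm (s : 'S_N) : measurable_fun setT (fun x => Psi (perm_tuple s x)).
  exact: (measurableT_comp mPsi (@measurable_perm_tuple _ T N s)).
transitivity (\int[tuple_measure mu N]_x \sum_(i : m.-tuple 'I_N) term i x).
  apply: eq_integral => x _.
  rewrite /marked -[zip x bits]/(val [tuple of zip x bits]) sum_distinct_seq_mset.
  rewrite big_mkcond ge0_sume_distrr; last by move=> i _; case: ifP.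
  by apply: eq_bigr => i _; rewrite kE.
rewrite ge0_integral_sum//; last 2 first.
- move=> i; have [s sE] := termP i; rewrite (funext sE).
  by case: (leading_selection i) => //; exact: measurable_cst.
- by move=> i x _; have [s ->] := termP i; case: ifP.
transitivity (\sum_(i : m.-tuple 'I_N | leading_selection i)
    \int[tuple_measure mu N]_x Psi x).
  rewrite [RHS]big_mkcond; apply: eq_bigr => i _.
  have [s sE] := termP i; under eq_integral do rewrite sE.
  case: (leading_selection i); last exact: integral0.
  exact: integral_perm_tuple.
rewrite sume_const; last by apply: integral_ge0 => x _; exact: Psi0.
rewrite (integral_tuple_cat mPsi Psi0).
under eq_integral do under eq_integral do rewrite /Psi head_tuple_cat tail_tuple_cat.
by rewrite (@eq_card _ _ [pred i | @leading_selection m n i]).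
Qed.

End leading_marked.

(** * Palm measures of a process with a labelled density *)

Section palm_of_leading_marked.
Context d (T : measurableType d) (R : realType) (m n : nat).
Variable mu : {sigma_finite_measure set T -> \bar R}.
Variable k : (m + n).-tuple T -> R.
Hypotheses (mk : measurable_fun setT k) (k0 : forall x, 0 <= k x).
Hypothesis k_perm : forall x x' : (m + n).-tuple T,
  perm_eq (zip x (leading_marks m n)) (zip x' (leading_marks m n)) -> k x = k x'.
Hypothesis k_uniq : forall x, k x != 0 -> uniq x.
Variable Q : probability (conf (T * bool)%type) R.
Hypothesis QE : forall E, measurable E ->
  Q E = (\int[tuple_measure mu (m + n)]_x
    (k x * \1_E (seq_mset (zip x (leading_marks m n)) : conf (T * bool)%type))%:E)%E.
Hypothesis diagT : measurable [set p : T * T | p.1 = p.2].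
Variable G : nat -> set T.
Hypothesis genG : @measurable _ T = <<s range G>>.
Variable nu : set (T * bool)%type -> \bar R.
Variable rho : m.-tuple (T * bool)%type -> R.
Variable palm : R.-pker (m.-tuple (T * bool)%type) ~> conf (T * bool)%type.
Hypothesis palmP : is_reduced_palm Q nu rho palm.
Local Open Scope ereal_scope.

(** Up to normalization, the probability of E for the unmarked points given that
    the points marked 1 are v; at the full space, the density of the marked
    points. *)
Definition section_weight (E : set (conf T)) (v : m.-tuple T) : \bar R :=
  \int[tuple_measure mu n]_y (k [tuple of v ++ y] * \1_E (seq_mset y : conf T))%:E.

Let palm_unmarked (v : m.-tuple T) (E : set (conf T)) : \bar R :=
  palm (mark_all true v) (@omit_marks d T @^-1` E).

Let measurable_cat_weight : measurable_fun setT
  (fun p : m.-tuple T * n.-tuple T => k [tuple of p.1 ++ p.2]).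
Proof. exact: (measurableT_comp mk (@measurable_cat_tuple _ T m n)). Qed.

Lemma measurable_section_weight E : measurable E ->
  measurable_fun setT (section_weight E).
Proof.
move=> mE; rewrite /section_weight.
apply: (@measurable_fun_fubini_tonelli_F _ _ _ _ _ (tuple_measure mu n)
  (fun p : m.-tuple T * n.-tuple T =>
    (k [tuple of p.1 ++ p.2] * \1_E (seq_mset p.2 : conf T))%:E)).
  apply/measurable_EFinP; apply: measurable_funM => //.
  apply: (measurableT_comp (measurable_indic mE)).
  exact: (measurableT_comp (@measurable_seq_mset _ T n) measurable_snd).
by move=> p; rewrite lee_fin mulr_ge0.
Qed.

Lemma section_weight_ge0 E v : 0 <= section_weight E v.
Proof. by apply: integral_ge0 => y _; rewrite lee_fin mulr_ge0. Qed.

Lemma section_weight_measure v : exists M : {measure set (conf T) -> \bar R},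
  forall E, M E = section_weight E v.
Proof.
apply: weighted_image_measure => //; last exact: measurable_seq_mset.
exact: (measurableT_comp measurable_cat_weight (pair1_measurable v)).
Qed.

Lemma section_weightT v :
  section_weight setT v = \int[tuple_measure mu n]_y (k [tuple of v ++ y])%:E.
Proof. by apply: eq_integral => y _; rewrite indicT mulr1. Qed.

Lemma section_weight_le E v : measurable E ->
  section_weight E v <= section_weight setT v.
Proof.
move=> mE; have [M ME] := section_weight_measure v.
by rewrite -!ME le_measure ?inE.
Qed.

Lemma section_weight_perm s v :
  section_weight setT (perm_tuple s v) = section_weight setT v.
Proof.
rewrite !section_weightT; apply: eq_integral => y _; congr EFin; apply: k_perm.
rewrite !zip_leading_marks perm_cat2r; apply: perm_map.
exact: perm_perm_tuple.
Qed.

Lemma integral_section_weight : \int[tuple_measure mu m]_v section_weight setT v = 1.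
Proof.
under eq_integral do rewrite section_weightT.
rewrite -(integral_tuple_cat mu (f := fun x => (k x)%:E))//; last first.
  exact/measurable_EFinP.
rewrite -(probability_setT Q) QE//; apply: eq_integral => x _.
by rewrite indicT mulr1.
Qed.

(** The correlation functions and the reference measure enter both identities
    only through the functional [phi |-> E sum phi], so they cancel out. *)
Lemma palm_exchange (phi : m.-tuple (T * bool) -> \bar R)
    (E : set (conf (T * bool)%type)) :
  measurable_fun setT phi -> (forall w, 0 <= phi w) -> measurable E ->
  \int[Q]_xi sum_distinct (fun w eta => phi w * (\1_E eta)%:E) xi =
  \int[Q]_xi sum_distinct (fun w _ => phi w * palm w E) xi.
Proof.
move=> mphi phi0 mE; have [[mrho rho0 corr] palmE] := palmP.
have mpE : measurable_fun setT (fun w => phi w * palm w E).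
  by apply: emeasurable_funM => //; exact: measurable_kernel.
rewrite corr//; last by move=> w; rewrite mule_ge0.
rewrite (palmE (fun p => phi p.1 * (\1_E p.2)%:E)).
- congr tuple_integral; apply/funext => w; congr (_ * _).
  rewrite /= ge0_integralZl//.
  + by rewrite integral_indic// setIT.
  + exact: measurable_EFin_indic.
- apply: emeasurable_funM; first exact: (measurableT_comp mphi measurable_fst).
  apply/measurable_EFinP.
  exact: (measurableT_comp (measurable_indic mE) measurable_snd).
- by move=> p; rewrite mule_ge0// lee_fin.
Qed.

Let marked_with (B : set (m.-tuple T)) : set (m.-tuple (T * bool)) :=
  [set w : m.-tuple (T * bool) | all snd w /\ B (map_tuple fst w)].

Let measurable_marked_with B : measurable B -> measurable (marked_with B).
Proof.
move=> mB.
have mall : measurable [set w : m.-tuple (T * bool) | all snd w].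
  rewrite (_ : mkset _ =
     \bigcap_(i in [set: 'I_m]) [set w : m.-tuple (T * bool) | snd (tnth w i) = true]).
    apply: fin_bigcap_measurable => // i _.
    have /(_ measurableT [set true]) := measurableT_comp
      (@measurable_snd _ _ T bool) (@measurable_tnth _ (T * bool)%type m i).
    by rewrite setTI; exact.
  apply/seteqP; split => [w /all_tnthP aw i _|w aw]; first exact: aw.
  by apply/all_tnthP => i; exact: aw.
apply: (measurableI _ _ mall).
have /(_ measurableT _ mB) :=
  @measurable_map_tuple _ _ _ _ m _ (@measurable_fst _ _ T bool).
by rewrite setTI; exact.
Qed.

(** The exchange identity for phi the indicator that all points carry the mark 1
    and lie in B: both sides are the same multiple of a labelled integral. *)
Lemma integral_palm_section (B : set (m.-tuple T)) (E : set (conf T)) :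
  measurable B -> measurable E ->
  \int[tuple_measure mu m]_(v in B) section_weight E v =
  \int[tuple_measure mu m]_(v in B) (palm_unmarked v E * section_weight setT v).
Proof.
move=> mB mE; pose E' := @omit_marks d T @^-1` E.
have mE' : measurable E'.
  by rewrite -[X in measurable X]setTI; exact: measurable_omit_marks.
pose phi (w : m.-tuple (T * bool)) : \bar R := (\1_(marked_with B) w)%:E.
have mphi : measurable_fun setT phi.
  by apply: measurable_EFin_indic; exact: measurable_marked_with.
have phi0 w : 0 <= phi w by rewrite lee_fin.
have phi_marks (w : m.-tuple (T * bool)) : ~~ all snd w -> phi w = 0.
  by move=> nw; rewrite /phi indicE memNset// => -[aw _]; rewrite aw in nw.
have phiE v : phi (mark_all true v) = (\1_B v)%:E.
  rewrite /phi !indicE; congr (_%:R%:E); congr nat_of_bool.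
  have mk_all : all snd (mark_all true v) by rewrite all_map; apply/allP.
  have fst_mark : map_tuple fst (mark_all true v) = v.
    by apply/val_inj; rewrite /= -map_comp map_id.
  apply/idP/idP => /set_mem; first by move=> [_]; rewrite fst_mark => /mem_set.
  by move=> Bv; apply/mem_set; split => //; rewrite fst_mark.
have := palm_exchange mphi phi0 mE'.
rewrite (integral_sum_distinct mk k0 k_perm k_uniq QE diagT
  (psi := fun p => phi p.1 * (\1_E' p.2)%:E)); last 3 first.
- apply: emeasurable_funM; first exact: (measurableT_comp mphi measurable_fst).
  apply/measurable_EFinP.
  exact: (measurableT_comp (measurable_indic mE') measurable_snd).
- by move=> p; rewrite mule_ge0// lee_fin.
- by move=> w eta nw /=; rewrite phi_marks// mul0e.
rewrite (integral_sum_distinct mk k0 k_perm k_uniq QE diagT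
  (psi := fun p => phi p.1 * palm p.1 E')); last 3 first.
- apply: emeasurable_funM; first exact: (measurableT_comp mphi measurable_fst).
  exact: (measurableT_comp (measurable_kernel palm E' mE') measurable_fst).
- by move=> p; rewrite mule_ge0// lee_fin.
- by move=> w eta nw /=; rewrite phi_marks// mul0e.
set c := (#|_|%:R)%R.
have c_neq0 : (c != 0)%R.
  rewrite pnatr_eq0 -lt0n; apply/card_gt0P.
  have [i li] := leading_selection_exists m n; by exists i.
have cancel (a : \bar R) : (c^-1)%R%:E * (c%:E * a) = a.
  by rewrite muleA -EFinM mulVf// mul1e.
move=> /(congr1 (fun a => (c^-1)%R%:E * a)); rewrite !cancel => eqI.
rewrite [LHS]integral_mkcond [RHS]integral_mkcond.
transitivity (\int[tuple_measure mu m]_v \int[tuple_measure mu n]_y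
    ((k [tuple of v ++ y])%:E *
      (phi (mark_all true v) * (\1_E' (seq_mset (mark_all false y)))%:E))).
  apply: eq_integral => v _; rewrite phiE /patch indicE.
  case: ifPn => vB; last by rewrite integral0_eq// => y _; rewrite mul0e mule0.
  apply: eq_integral => y _; rewrite mul1e EFinM; congr (_ * _%:E).
  rewrite !indicE; congr (_%:R); congr nat_of_bool.
  rewrite /E' /in_mem /= /in_set /preimage /=; congr (asbool (E _)).
  by rewrite omit_marks_seq_mset -map_comp map_id.
rewrite eqI; apply: eq_integral => v _ /=; rewrite phiE /patch indicE.
case: ifPn => vB; last by rewrite integral0_eq// => y _; rewrite mul0e mule0.
under eq_integral do rewrite mul1e.
rewrite ge0_integralZr//.
- by rewrite muleC section_weightT.
- apply/measurable_EFinP.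
  exact: (measurableT_comp measurable_cat_weight (pair1_measurable v)).
- by move=> y _; rewrite lee_fin.
Qed.

Let weight_integrable : (tuple_measure mu m).-integrable setT (section_weight setT).
Proof.
apply/integrableP; split; first exact: measurable_section_weight.
under eq_integral do rewrite gee0_abs ?section_weight_ge0//.
by rewrite integral_section_weight ltry.
Qed.

Let measurable_palm_unmarked E : measurable E ->
  measurable_fun setT (fun v => palm_unmarked v E).
Proof.
move=> mE; rewrite /palm_unmarked.
have mE' : measurable (@omit_marks d T @^-1` E).
  by rewrite -[X in measurable X]setTI; exact: measurable_omit_marks.
apply: (measurableT_comp (measurable_kernel palm _ mE')).
by apply: measurable_map_tuple; exact: measurable_fun_pair.
Qed.

Lemma ae_palm_section (E : set (conf T)) : measurable E ->
  {ae tuple_measure mu m, forall v,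
    section_weight E v = palm_unmarked v E * section_weight setT v}.
Proof.
move=> mE.
have : ae_eq (tuple_measure mu m) setT (section_weight E)
    (fun v => palm_unmarked v E * section_weight setT v).
  apply: integral_ae_eq => //.
  - apply: le_integrable weight_integrable => //.
      exact: measurable_section_weight.
    move=> v _; rewrite !gee0_abs ?section_weight_ge0//.
    exact: section_weight_le.
  - apply: emeasurable_funM; first exact: measurable_palm_unmarked.
    exact: measurable_section_weight.
  - by move=> B _ mB; exact: integral_palm_section.
by apply: filterS => v; apply.
Qed.

Lemma ae_palm_cylinders : {ae tuple_measure mu m, forall v,
  section_weight setT v < +oo /\ forall l, section_weight (cylinder G l) v =
    palm_unmarked v (cylinder G l) * section_weight setT v}.
Proof.
have fin_ae := integrable_ae measurableT weight_integrable.
pose dec := @choice.unpickle (seq (seq nat * nat) : countType).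
pose agree l v := section_weight (cylinder G l) v =
      palm_unmarked v (cylinder G l) * section_weight setT v.
have agree_ae l : {ae tuple_measure mu m, forall v, agree l v}.
  by apply: ae_palm_section; exact: measurable_cylinder.
pose agree_code j v : Prop := if dec j is Some l then agree l v else True.
have cyl_ae j : {ae tuple_measure mu m, forall v, agree_code j v}.
  case decj : (dec j) => [l|]; last by apply: aeW => v; rewrite /agree_code decj.
  by apply: filterS (agree_ae l) => v; rewrite /agree_code decj.
have := ae_foralln cyl_ae.
move: fin_ae; apply: filterS2 => v /(_ Logic.I) vfin vcyl; split.
  by rewrite -ge0_fin_numE// section_weight_ge0.
by move=> l; have := vcyl (choice.pickle l); rewrite /agree_code /dec choice.pickleK.
Qed.

Lemma measurable_image_seq_mset (B : set (m.-tuple T)) : measurable B ->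
  measurable [set xi : conf T | exists2 v : m.-tuple T, B v & seq_mset v = xi].
Proof.
move=> mB; apply: measurable_conf_tuples => p.
have [->|pm] := eqVneq p m; last first.
  rewrite (_ : mkset _ = set0)//; apply/seteqP; split => // x [v _].
  move/eq_seq_msetP/perm_size; rewrite !size_tuple => mp.
  by rewrite mp eqxx in pm.
rewrite (_ : mkset _ = \bigcup_(s in [set: 'S_m])
    [set x : m.-tuple T | B (perm_tuple s x)]).
  apply: fin_bigcup_measurable => [|s _]; first exact: finite_finset.
  have /(_ measurableT _ mB) := @measurable_perm_tuple _ T m s.
  by rewrite setTI; exact.
apply/seteqP; split => [x [v Bv /eq_seq_msetP/perm_tupleP[s vs]]|x [s _ Bs]].
  by exists s => //=; rewrite -vs.
by exists (perm_tuple s x) => //; apply: seq_mset_perm; exact: perm_perm_tuple.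
Qed.

(** The exceptional tuples v have weight 0 or lie in a null set N. By symmetry of
    the weight the same is true of their relabellings, so the configurations
    listed by exceptional tuples have probability 0. *)
Lemma ae_cond_ensemble :
  {ae pushforward Q (@points_of_mark d T true), forall xi1 : conf T,
    forall v : m.-tuple T, seq_mset v = xi1 ->
    [/\ 0 < section_weight setT v, section_weight setT v < +oo &
      forall E, measurable E ->
        section_weight E v = section_weight setT v * cond_ensemble palm v E]}.
Proof.
have [N [mN N0 Ngood]] := ae_palm_cylinders.
have mW := measurable_section_weight measurableT.
(* Tuples of weight 0 need not be null for the product measure, but they are
   null for the law of the marked points. *)
pose B := N `|` [set v | section_weight setT v = 0].
have mB : measurable B.
  by apply: measurableU => //; have := mW measurableT [set 0] (emeasurable_set1 _);
     rewrite setTI; exact.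
have mA := measurable_image_seq_mset mB.
exists [set xi : conf T | exists2 v : m.-tuple T, B v & seq_mset v = xi].
split => //; last first.
  move=> xi1 /= nP; apply: contrapT => nA; apply: nP => v vxi.
  have nB : ~ B v by move=> Bv; apply: nA; exists v.
  have [Wfin cylE] : section_weight setT v < +oo /\ forall l,
      section_weight (cylinder G l) v =
      palm_unmarked v (cylinder G l) * section_weight setT v.
    by apply: contrapT => bad; apply: nB; left; exact: Ngood.
  have W0 : 0 < section_weight setT v.
    rewrite lt_def section_weight_ge0 andbT; apply/eqP => W0.
    by apply: nB; right.
  split => // E mE.
  have [M ME] := section_weight_measure v.
  pose pv : {measure set (conf T) -> \bar R} :=
    measure_function_pushforward__canonical__measure_function_Measure
      (palm (mark_all true v)) (@measurable_omit_marks _ T).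
  have c0 : (0 <= fine (section_weight setT v))%R by exact/fine_ge0/section_weight_ge0.
  have cE : (fine (section_weight setT v))%:E = section_weight setT v.
    by rewrite fineK// ge0_fin_numE// section_weight_ge0.
  have := @eq_measure_conf _ T G genG R M (mscale (NngNum c0) pv).
  rewrite ME => /(_ Wfin) h.
  have scaleE F : mscale (NngNum c0) pv F =
      section_weight setT v * cond_ensemble palm v F by rewrite -[in RHS]cE.
  have Mcyl l : M (cylinder G l) = mscale (NngNum c0) pv (cylinder G l).
    by rewrite ME cylE muleC; exact/esym/scaleE.
  by rewrite -ME -[RHS]scaleE; exact: h.
pose A := [set xi : conf T | exists2 v : m.-tuple T, B v & seq_mset v = xi].
have mpA : measurable (@points_of_mark d T true @^-1` A).
  by rewrite -[X in measurable X]setTI; exact: measurable_points_of_mark.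
rewrite /pushforward QE//.
rewrite (integral_tuple_cat mu (f := fun x : (m + n).-tuple T =>
  (k x * \1_(@points_of_mark d T true @^-1` A)
    (seq_mset (zip x (leading_marks m n)) : conf (T * bool)%type))%:E)); last 2 first.
- apply/measurable_EFinP; apply: measurable_funM => //.
  apply: (measurableT_comp (measurable_indic mpA)).
  apply: (measurableT_comp (@measurable_seq_mset _ (T * bool)%type (m + n)%N)).
  exact: measurable_zip_tuple.
- by move=> x; rewrite lee_fin mulr_ge0.
transitivity (\int[tuple_measure mu m]_v
    (section_weight setT v * (\1_A (seq_mset v : conf T))%:E)).
  apply: eq_integral => v _.
  have indE (y : n.-tuple T) : \1_(@points_of_mark d T true @^-1` A)
      (seq_mset (zip [tuple of v ++ y] (leading_marks m n)) : conf (T * bool)%type) =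
      \1_A (seq_mset v : conf T) :> R.
    rewrite !indicE; congr (_%:R); congr nat_of_bool.
    rewrite /in_mem /= /in_set /preimage /=; congr (asbool (A _)).
    rewrite zip_leading_marks points_of_mark_seq_mset filter_cat map_cat.
    rewrite /mark_all /= !filter_map (@eq_filter _ _ predT)// filter_predT.
    by rewrite (@eq_filter _ _ pred0)// filter_pred0 cats0 -map_comp map_id.
  under eq_integral do rewrite indE EFinM.
  rewrite ge0_integralZr//.
  - by rewrite section_weightT.
  - apply/measurable_EFinP.
    exact: (measurableT_comp measurable_cat_weight (pair1_measurable v)).
  - by move=> y _; rewrite lee_fin.
have notN s : {ae tuple_measure mu m, forall v, ~ N (perm_tuple s v)}.
  have mNs : measurable [set v : m.-tuple T | N (perm_tuple s v)].
    have /(_ measurableT _ mN) := @measurable_perm_tuple _ T m s.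
    by rewrite setTI; exact.
  exists [set v | N (perm_tuple s v)]; split => //; last by move=> v /contrapT.
  have indicI F : measurable F -> tuple_measure mu m F =
      \int[tuple_measure mu m]_v (\1_F v)%:E.
    by move=> mF; rewrite integral_indic// setIT.
  rewrite -N0 !indicI// -(integral_perm_tuple mu s (f := fun v => (\1_N v)%:E))//.
  exact: measurable_EFin_indic.
rewrite (@ge0_ae_eq_integral _ _ _ _ setT _ (cst 0))//.
- exact: integral0.
- apply: emeasurable_funM => //.
  apply/measurable_EFinP; apply: (measurableT_comp (measurable_indic mA)).
  exact: measurable_seq_mset.
- by move=> v _; rewrite mule_ge0// ?section_weight_ge0// lee_fin.
- have allN : {ae tuple_measure mu m, forall v, forall s, ~ N (perm_tuple s v)}.
    exact: filter_forall.
  apply: filterS allN => v nN _ /=.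
  have [Av|nAv] := pselect (A (seq_mset v)); last first.
    by rewrite indicE memNset// mule0.
  have [v' Bv' /eq_seq_msetP/perm_tupleP[s v'E]] := Av.
  move: Bv'; rewrite v'E => -[Ns|]; first by case: (nN s).
  by rewrite /= section_weight_perm => ->; rewrite mul0e.
Qed.

End palm_of_leading_marked.

(** * Marked orthogonal polynomial ensembles *)

Section ope_density.
Context d (T : measurableType d) (R : realType) (dist : T -> T -> R).
Hypothesis dist_sym : forall x y, dist x y = dist y x.

Definition sqr_vandermonde n (x : n.-tuple T) : R :=
  \prod_(i < n) \prod_(j < n | (i < j)%N) dist (tnth x j) (tnth x i) ^+ 2.

(** Indexing by all ordered pairs makes the invariance under permutations
    evident. *)
Lemma sqr_vandermonde_offdiag n (x : n.-tuple T) :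
  sqr_vandermonde x =
  \prod_(i < n) \prod_(j < n | j != i) dist (tnth x i) (tnth x j).
Proof.
have -> : \prod_(i < n) \prod_(j < n | j != i) dist (tnth x i) (tnth x j) =
    (\prod_(i < n) \prod_(j < n | (i < j)%N) dist (tnth x i) (tnth x j)) *
    (\prod_(i < n) \prod_(j < n | (j < i)%N) dist (tnth x i) (tnth x j)).
  rewrite -big_split; apply: eq_bigr => i _ /=.
  rewrite (bigID (fun j : 'I_n => (i < j)%N)) /=; congr (_ * _); apply: eq_bigl => j.
    by rewrite -val_eqE /=; case: ltngtP.
  by rewrite -val_eqE /=; case: ltngtP.
have -> : \prod_(i < n) \prod_(j < n | (j < i)%N) dist (tnth x i) (tnth x j) =
    \prod_(i < n) \prod_(j < n | (i < j)%N) dist (tnth x i) (tnth x j).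
  rewrite (exchange_big_dep predT)//=; apply: eq_bigr => i _.
  by apply: eq_bigr => j _.
rewrite -big_split; apply: eq_bigr => i _ /=.
by rewrite -big_split; apply: eq_bigr => j _ /=; rewrite expr2 !(dist_sym (tnth x j)).
Qed.

Lemma sqr_vandermonde_perm n s (x : n.-tuple T) :
  sqr_vandermonde (perm_tuple s x) = sqr_vandermonde x.
Proof.
rewrite !sqr_vandermonde_offdiag [RHS](reindex_inj (@perm_inj _ s)) /=.
apply: eq_bigr => i _; rewrite [RHS](reindex_inj (@perm_inj _ s)) /=.
apply: eq_big => [j|j _]; first by rewrite (inj_eq perm_inj).
by rewrite !tnth_mktuple.
Qed.

Lemma sqr_vandermonde_ge0 n (x : n.-tuple T) : 0 <= sqr_vandermonde x.
Proof. by apply: prodr_ge0 => i _; apply: prodr_ge0 => j _; exact: sqr_ge0. Qed.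

Lemma sqr_vandermonde_cat m n (v : m.-tuple T) (y : n.-tuple T) :
  sqr_vandermonde [tuple of v ++ y] =
  sqr_vandermonde v * (sqr_vandermonde y *
    \prod_(x <- y) \prod_(z <- v) dist x z ^+ 2).
Proof.
rewrite /sqr_vandermonde big_split_ord /=.
have headE : \prod_(i < m) \prod_(j < m + n | (lshift n i < j)%N)
      dist (tnth [tuple of v ++ y] j) (tnth [tuple of v ++ y] (lshift n i)) ^+ 2 =
    (\prod_(i < m) \prod_(j < m | (i < j)%N) dist (tnth v j) (tnth v i) ^+ 2) *
    \prod_(i < m) \prod_(j < n) dist (tnth y j) (tnth v i) ^+ 2.
  rewrite -big_split; apply: eq_bigr => i _ /=.
  rewrite big_split_ord /=; congr (_ * _).
    by apply: eq_bigr => j _; rewrite !tnth_lshift.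
  apply: eq_big => [j|j _]; first by rewrite (leq_trans (ltn_ord i))// leq_addr.
  by rewrite tnth_lshift tnth_rshift.
have tailE : \prod_(i < n) \prod_(j < m + n | (rshift m i < j)%N)
      dist (tnth [tuple of v ++ y] j) (tnth [tuple of v ++ y] (rshift m i)) ^+ 2 =
    \prod_(i < n) \prod_(j < n | (i < j)%N) dist (tnth y j) (tnth y i) ^+ 2.
  apply: eq_bigr => i _; rewrite big_split_ord /= big_pred0 ?mul1r.
    apply: eq_big => [j|j _]; first by rewrite ltn_add2l.
    by rewrite !tnth_rshift.
  by move=> j /=; apply/negbTE; rewrite -leqNgt ltnW// ltn_addr.
rewrite headE tailE exchange_big /= -mulrA; congr (_ * _); rewrite mulrC; congr (_ * _).
by rewrite big_tuple; apply: eq_bigr => j _; rewrite big_tuple.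
Qed.

Lemma ope_densityE n (w : T -> R) (x : n.-tuple T) :
  ope_density dist w x = sqr_vandermonde x * \prod_(z <- x) w z.
Proof. by rewrite /ope_density big_tuple. Qed.

Lemma ope_density_ge0 n (w : T -> R) (x : n.-tuple T) :
  (forall z, 0 <= w z) -> 0 <= ope_density dist w x.
Proof.
move=> w0; rewrite ope_densityE mulr_ge0 ?sqr_vandermonde_ge0//.
exact: prodr_ge0.
Qed.

Lemma ope_density_perm n (w : T -> R) (x x' : n.-tuple T) :
  perm_eq x x' -> ope_density dist w x = ope_density dist w x'.
Proof.
move=> xx'; rewrite !ope_densityE (perm_big _ xx').
by have [s ->] := perm_tupleP xx'; rewrite sqr_vandermonde_perm.
Qed.

Hypothesis dist_eq0 : forall x, dist x x = 0.

Lemma ope_density_uniq n (w : T -> R) (x : n.-tuple T) :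
  ope_density dist w x != 0 -> uniq x.
Proof.
rewrite ope_densityE mulf_eq0 negb_or sqr_vandermonde_offdiag => /andP[+ _].
move=> /prodf_neq0 V; apply/tuple_uniqP => i j xij.
apply: contrapT => /eqP ij; have /prodf_neq0/(_ j) := V i isT.
by rewrite eq_sym xij dist_eq0 eqxx ij => /(_ isT).
Qed.

Hypothesis mdist : measurable_fun setT (fun p : T * T => dist p.1 p.2).

Lemma measurable_ope_density n (w : T -> R) : measurable_fun setT w ->
  measurable_fun setT (fun x : n.-tuple T => ope_density dist w x).
Proof.
move=> mw; apply: measurable_funM.
  apply: measurable_prod => i _.
  under eq_fun do rewrite big_mkcond.
  apply: measurable_prod => j _; case: (i < j)%N; last exact: measurable_cst.
  apply: measurable_funX.
  exact: (measurableT_comp mdist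
    (measurable_fun_pair (@measurable_tnth _ T n j) (@measurable_tnth _ T n i))).
apply: measurable_prod => j _.
exact: (measurableT_comp mw (@measurable_tnth _ T n j)).
Qed.

Lemma measurable_cond_weight (w theta : T -> R) (v : seq T) :
  measurable_fun setT w -> measurable_fun setT theta ->
  measurable_fun setT (cond_weight dist w theta v).
Proof.
move=> mw mtheta; rewrite /cond_weight; apply: measurable_funM.
  by apply: measurable_funM => //; apply: measurable_funB.
apply: measurable_prod => y _; apply: measurable_funX.
exact: (measurableT_comp mdist (pair2_measurable y)).
Qed.

Lemma cond_weight_ge0 (w theta : T -> R) (v : seq T) x :
  (forall z, 0 <= w z) -> (forall z, 0 <= theta z <= 1) ->
  0 <= cond_weight dist w theta v x.
Proof.
move=> w0 theta01; rewrite /cond_weight !mulr_ge0// ?prodr_ge0//.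
  by rewrite subr_ge0; case/andP: (theta01 x).
by move=> y _; exact: sqr_ge0.
Qed.

(** The interaction between the observed and the remaining points turns into an
    external field acting on the latter. *)
Lemma ope_density_cat m n (w theta : T -> R) (v : m.-tuple T) (y : n.-tuple T) :
  ope_density dist w [tuple of v ++ y] *
    mark_weight theta (zip [tuple of v ++ y] (leading_marks m n)) =
  ope_density dist w v * \prod_(z <- v) theta z *
    ope_density dist (cond_weight dist w theta v) y.
Proof.
rewrite zip_leading_marks /mark_weight big_cat /= !big_map /=.
rewrite !ope_densityE sqr_vandermonde_cat big_cat /= /cond_weight.
by rewrite 2!big_split /=; ring.
Qed.

End ope_density.

Section conditional_ope.
Context d (T : measurableType d) (R : realType) (m n : nat).
Variables (mu : {sigma_finite_measure set T -> \bar R}) (dist : T -> T -> R).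
Hypothesis dist_sym : forall x y, dist x y = dist y x.
Hypothesis dist_eq0 : forall x y, dist x y = 0 <-> x = y.
Hypothesis mdist : measurable_fun setT (fun p : T * T => dist p.1 p.2).
Variable G : nat -> set T.
Hypothesis genG : @measurable _ T = <<s range G>>.
Variables (w theta : T -> R).
Hypotheses (mw : measurable_fun setT w) (w0 : forall x, 0 <= w x).
Hypotheses (mtheta : measurable_fun setT theta)
  (theta01 : forall x, 0 <= theta x <= 1).
Variables (P : probability (conf T) R) (Ptheta : probability (conf (T * bool)%type) R).
Hypotheses (opeP : ope_law mu dist (m + n) w P) (markP : is_marking theta P Ptheta).
Hypothesis num_marked_gt0 : (0 < Ptheta (@num_marked1 _ T m))%E.
Local Open Scope ereal_scope.

Let N := (m + n)%N.
Let bits := leading_marks m n.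

Lemma mark_weight_ge0 (s : seq (T * bool)) : (0 <= mark_weight theta s)%R.
Proof.
apply: prodr_ge0 => -[x b] _ /=; have /andP[t0 t1] := theta01 x.
by case: b => //; rewrite subr_ge0.
Qed.

Lemma mark_weight_perm (s t : seq (T * bool)) :
  perm_eq s t -> mark_weight theta s = mark_weight theta t.
Proof. exact: perm_big. Qed.

Lemma measurable_mark_weight p (b : p.-tuple bool) :
  measurable_fun setT (fun x : p.-tuple T => mark_weight theta (zip x b)).
Proof.
rewrite (_ : (fun _ => _) = fun x : p.-tuple T =>
    (\prod_(i < p) (if tnth b i then theta (tnth x i) else 1 - theta (tnth x i)))%R).
  apply: measurable_prod => i _.
  have mti := measurableT_comp mtheta (@measurable_tnth _ T p i).
  by case: (tnth b i) => //; apply: measurable_funB.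
apply/funext => x; rewrite /mark_weight -[zip x b]/(val [tuple of zip x b]) big_tuple.
by apply: eq_bigr => i _; rewrite tnth_zip.
Qed.

Let measurable_zip_indic p (b : p.-tuple bool) (E : set (conf (T * bool)%type)) :
  measurable E -> measurable_fun setT (fun x : p.-tuple T =>
    \1_E (seq_mset (zip x b) : conf (T * bool)%type) : R).
Proof.
move=> mE; apply: (measurableT_comp (measurable_indic mE)).
apply: (measurableT_comp (@measurable_seq_mset _ (T * bool)%type p)).
exact: measurable_zip_tuple.
Qed.

Let Zinv := ((fine (ope_partition mu dist N w))^-1)%R.

Let Zinv_ge0 : (0 <= Zinv)%R.
Proof. by case: opeP => Z0 _ _; rewrite invr_ge0 fine_ge0// ltW. Qed.

Let f (x : N.-tuple T) : R := (Zinv * ope_density dist w x)%R.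

Let f_ge0 (x : N.-tuple T) : (0 <= f x)%R.
Proof. by rewrite mulr_ge0// ope_density_ge0. Qed.

Let measurable_f : measurable_fun setT (f : N.-tuple T -> R).
Proof. by apply: measurable_funM => //; exact: measurable_ope_density. Qed.

Lemma ope_law_integral E : measurable E ->
  P E = \int[tuple_measure mu N]_x (f x * \1_E (seq_mset x : conf T))%:E.
Proof.
move=> mE; case: opeP => _ _ ->//.
have mI : measurable_fun setT (fun x : N.-tuple T =>
    (ope_density dist w x * \1_E (seq_mset x : conf T))%:E).
  apply/measurable_EFinP; apply: measurable_funM.
    exact: measurable_ope_density.
  exact: (measurableT_comp (measurable_indic mE) (@measurable_seq_mset _ T N)).
have I0 (x : N.-tuple T) : 0 <= (ope_density dist w x * \1_E (seq_mset x : conf T))%:E.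
  by rewrite lee_fin mulr_ge0// ope_density_ge0.
rewrite tuple_integralE// -ge0_integralZl//.
by apply: eq_integral => x _; rewrite -EFinM mulrA.
Qed.

Let marked_weight (b : N.-tuple bool) (x : N.-tuple T) : R :=
  (f x * mark_weight theta (zip x b))%R.

Let marked_weight_ge0 b x : (0 <= marked_weight b x)%R.
Proof. by rewrite mulr_ge0// mark_weight_ge0. Qed.

Let measurable_marked_weight b : measurable_fun setT (marked_weight b).
Proof. by apply: measurable_funM => //; exact: measurable_mark_weight. Qed.

Let measurable_marked_indic b (E : set (conf (T * bool)%type)) : measurable E ->
  measurable_fun setT (fun x : N.-tuple T =>
    (marked_weight b x * \1_E (seq_mset (zip x b) : conf (T * bool)%type))%:E).
Proof.
move=> mE; apply/measurable_EFinP; apply: measurable_funM.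
  exact: measurable_marked_weight.
exact: measurable_zip_indic.
Qed.

Lemma marking_law_tuples E : measurable E ->
  Ptheta E = \sum_(b : N.-tuple bool) \int[tuple_measure mu N]_x
    (marked_weight b x * \1_E (seq_mset (zip x b) : conf (T * bool)%type))%:E.
Proof.
move=> mE; rewrite markP//.
have mlaw : measurable_fun setT (fun xi => mark_law theta xi E : \bar R).
  apply: measurable_fun_conf_tuples => p.
  under eq_fun do rewrite mark_law_seq_mset.
  apply/measurable_EFinP; apply: measurable_sum => b; apply: measurable_funM.
    exact: measurable_mark_weight.
  exact: measurable_zip_indic.
have law_ge0 xi : 0 <= mark_law theta xi E.
  rewrite lee_fin; apply: sumr_ge0 => b _; rewrite mulr_ge0//.
  exact: mark_weight_ge0.
rewrite (integral_weighted_image measurable_f f_ge0 (@measurable_seq_mset _ T N)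
  ope_law_integral mlaw law_ge0).
rewrite -ge0_integral_sum//; last 2 first.
- by move=> b; exact: measurable_marked_indic.
- by move=> b x _; rewrite lee_fin mulr_ge0// marked_weight_ge0.
apply: eq_integral => x _; rewrite mark_law_seq_mset -EFinM sumEFin.
by congr EFin; rewrite mulr_sumr; apply: eq_bigr => b _; rewrite mulrA.
Qed.

Let integral_marked_perm (b b' : N.-tuple bool)
    (E : set (conf (T * bool)%type)) : measurable E -> perm_eq b b' ->
  \int[tuple_measure mu N]_x
    (marked_weight b x * \1_E (seq_mset (zip x b) : conf (T * bool)%type))%:E =
  \int[tuple_measure mu N]_x
    (marked_weight b' x * \1_E (seq_mset (zip x b') : conf (T * bool)%type))%:E.
Proof.
move=> mE /perm_tupleP[s bE].
rewrite -(integral_perm_tuple mu s (f := fun x => (marked_weight b x *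
  \1_E (seq_mset (zip x b) : conf (T * bool)%type))%:E)).
- apply: eq_integral => x _; congr EFin.
  have zE : zip (perm_tuple s x) b = perm_tuple s [tuple of zip x b'].
    by rewrite -zip_perm_tuple bE.
  have zz : perm_eq (zip (perm_tuple s x) b) (zip x b').
    by rewrite zE; exact: perm_perm_tuple.
  rewrite /marked_weight /f (mark_weight_perm zz) (seq_mset_perm zz).
  by rewrite (ope_density_perm dist_sym w (perm_perm_tuple s x)).
- exact: measurable_marked_indic.
- by move=> x; rewrite lee_fin mulr_ge0// marked_weight_ge0.
Qed.

Lemma num_marked1_seq_mset (x : N.-tuple T) (b : N.-tuple bool) :
  num_marked1 m (seq_mset (zip x b)) <-> perm_eq b bits.
Proof.
rewrite /num_marked1 /= points_of_mark_seq_mset npoints_seq_mset.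
have -> : count (fun y => y \in [set: T])
    [seq p.1 | p <- zip x b & p.2 == true] = count id b.
  rewrite (eq_count (a2 := predT)); last by move=> y; rewrite in_setT.
  rewrite count_predT size_map size_filter.
  have -> : count id b = count id (unzip2 (zip x b)) by rewrite unzip2_zip ?size_tuple.
  by rewrite count_map; apply: eq_count => -[y c] /=; rewrite eqb_id.
have cbits : count id bits = m.
  by rewrite /bits /= count_cat !count_nseq /= mul1n mul0n addn0.
split => [cb|pb]; last by rewrite -cbits; exact/seq.permP.
have count_b (t : N.-tuple bool) : count (pred1 true) t = count id t.
  by apply: eq_count => -[].
have count_nb (t : N.-tuple bool) : count (pred1 false) t = (N - count id t)%N.
  have cnt : (count id t + count_mem false t)%N = N.
    rewrite -[RHS](size_tuple t) -(count_predC id t); congr addn.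
    by apply: eq_count => -[].
  by have := addKn (count id t) (count_mem false t); rewrite cnt.
apply/allP => -[] _ /=; first by rewrite !count_b cb cbits.
by rewrite !count_nb cb cbits.
Qed.

Let pM := fine (Ptheta (@num_marked1 _ T m)).
Let c := (#|[pred b : N.-tuple bool | perm_eq b bits]|%:R * pM^-1)%R.

(** Conditioning on m marks 1 keeps the sequences of marks that are permutations
    of 1^m 0^n. They all contribute alike, so the first one represents them, with
    their number as a factor in the constant. *)
Lemma cond_num_marked1_tuples E : measurable E ->
  cond_num_marked1 Ptheta m E = \int[tuple_measure mu N]_x
    (c * marked_weight bits x *
      \1_E (seq_mset (zip x bits) : conf (T * bool)%type))%:E.
Proof.
move=> mE; have mM := @measurable_num_marked1 _ T m.
have M_fin : Ptheta (num_marked1 m) \is a fin_num by exact: fin_num_measure.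
have pM_gt0 : (0 < pM)%R by rewrite /pM fine_gt0// num_marked_gt0 ltey_eq M_fin.
have restrT : mrestr Ptheta (@measurable_num_marked1 _ T m) setT =
    Ptheta (num_marked1 m) by rewrite /mrestr setTI.
rewrite /cond_num_marked1 /= /mnormalize /= restrT.
rewrite gt_eqF//= lt_eqF ?ltey_eq ?M_fin//= -/pM.
have mEM : measurable (E `&` num_marked1 m) by exact: measurableI.
rewrite /mrestr marking_law_tuples//.
transitivity ((\sum_(b : N.-tuple bool | perm_eq b bits) \int[tuple_measure mu N]_x
    (marked_weight bits x *
      \1_E (seq_mset (zip x bits) : conf (T * bool)%type))%:E) * (pM^-1)%:E).
  congr (_ * _); rewrite [RHS]big_mkcond; apply: eq_bigr => b _.
  case: ifPn => [pb|npb].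
    rewrite (integral_marked_perm mEM pb); apply: eq_integral => x _.
    congr ((_ * _)%:E); rewrite !indicE; congr (_%:R); congr nat_of_bool.
    have xM : num_marked1 m (seq_mset (zip x bits)) by apply/num_marked1_seq_mset.
    by apply/idP/idP => /set_mem; [move=> [/mem_set]|move=> xE; exact/mem_set].
  rewrite integral0_eq// => x _; rewrite indicE memNset ?mulr0//.
  by move=> [_ /num_marked1_seq_mset]; exact/negP.
rewrite sume_const; last first.
  by apply: integral_ge0 => x _; rewrite lee_fin mulr_ge0// marked_weight_ge0.
rewrite muleAC -EFinM -/c -ge0_integralZl//.
- by apply: eq_integral => x _; rewrite -EFinM mulrA.
- exact: measurable_marked_indic.
- by move=> x _; rewrite lee_fin mulr_ge0// marked_weight_ge0.
- by rewrite lee_fin mulr_ge0// invr_ge0 ltW.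
Qed.

Let k x := (c * marked_weight bits x)%R.

Let k_cat (v : m.-tuple T) (y : n.-tuple T) : k [tuple of v ++ y] =
  (c * Zinv * (ope_density dist w v * \prod_(z <- v) theta z) *
   ope_density dist (cond_weight dist w theta v) y)%R.
Proof.
by rewrite /k /marked_weight /f /bits -(mulrA Zinv) ope_density_cat; ring.
Qed.

Lemma measurable_diagonal : measurable [set p : T * T | p.1 = p.2].
Proof.
have /(_ measurableT [set 0%R] (measurable_set1 _)) := mdist.
rewrite setTI (_ : _ @^-1` _ = [set p | p.1 = p.2])//.
by apply/seteqP; split => p /= /dist_eq0.
Qed.

(** The labelled density of the marked process splits as a function of the
    observed points times the density of the conditional ensemble; the first
    factor cancels in the conditional law. *)
Lemma ope_law_cond_ensemble nu rho
    (palm : R.-pker (m.-tuple (T * bool)%type) ~> conf (T * bool)%type) :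
  is_reduced_palm (cond_num_marked1 Ptheta m) nu rho palm ->
  {ae pushforward (cond_num_marked1 Ptheta m) (@points_of_mark d T true),
    forall xi1 : conf T, forall v : m.-tuple T, seq_mset v = xi1 ->
    ope_law mu dist n (cond_weight dist w theta v) (cond_ensemble palm v)}.
Proof.
move=> palmP.
have c_ge0 : (0 <= c)%R by rewrite mulr_ge0// invr_ge0 fine_ge0.
have mk : measurable_fun setT k.
  by apply: measurable_funM => //; exact: measurable_marked_weight.
have k0 x : (0 <= k x)%R by rewrite mulr_ge0// marked_weight_ge0.
have k_perm (x x' : N.-tuple T) :
    perm_eq (zip x bits) (zip x' bits) -> k x = k x'.
  move=> xx'; have : perm_eq x x'.
    have := perm_map fst xx'; rewrite -/unzip1.
    by rewrite !unzip1_zip ?size_tuple.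
  move=> /(ope_density_perm dist_sym w) dE.
  by rewrite /k /marked_weight /f dE (mark_weight_perm xx').
have k_uniq x : k x != 0%R -> uniq x.
  move=> kx; apply: (@ope_density_uniq _ _ _ dist dist_sym _ N w).
    by move=> z; apply/dist_eq0.
  apply: contraNneq kx; rewrite /k /marked_weight /f => ->.
  by rewrite mulr0 mul0r mulr0.
have [A [mA A0 Agood]] := ae_cond_ensemble mk k0 k_perm k_uniq
  cond_num_marked1_tuples measurable_diagonal genG palmP.
exists A; split => //; apply: subset_trans Agood; apply: subsetC => xi /= good v vxi.
have {good} [W0 Woo WE] := good v vxi.
pose C := (c * Zinv * (ope_density dist w v * \prod_(z <- v) theta z))%R.
pose wv := cond_weight dist w theta v.
have wv0 z : (0 <= wv z)%R by exact: cond_weight_ge0.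
have mwv : measurable_fun setT wv by exact: measurable_cond_weight.
have C0 : (0 <= C)%R.
  have th0 : (0 <= \prod_(z <- v) theta z)%R.
    by apply: prodr_ge0 => z _; case/andP: (theta01 z).
  have dv0 : (0 <= ope_density dist w v)%R by exact: ope_density_ge0.
  exact: (mulr_ge0 (mulr_ge0 c_ge0 Zinv_ge0) (mulr_ge0 dv0 th0)).
have weightE E : measurable E -> section_weight mu k E v =
    C%:E * tuple_integral mu (fun y : n.-tuple T =>
      (ope_density dist wv y * \1_E (seq_mset y : conf T))%:E).
  move=> mE.
  have mI : measurable_fun setT (fun y : n.-tuple T =>
      (ope_density dist wv y * \1_E (seq_mset y : conf T))%:E).
    apply/measurable_EFinP; apply: measurable_funM.
      exact: measurable_ope_density.
    exact: (measurableT_comp (measurable_indic mE) (@measurable_seq_mset _ T n)).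
  have I0 (y : n.-tuple T) :
      0 <= (ope_density dist wv y * \1_E (seq_mset y : conf T))%:E.
    by rewrite lee_fin mulr_ge0// ope_density_ge0.
  rewrite tuple_integralE// -ge0_integralZl//.
  by apply: eq_integral => y _; rewrite k_cat -EFinM [in RHS]mulrA.
have partE : tuple_integral mu (fun y : n.-tuple T =>
      (ope_density dist wv y * \1_[set: conf T] (seq_mset y : conf T))%:E) =
    ope_partition mu dist n wv.
  by congr tuple_integral; apply/funext => y; rewrite indicT mulr1.
have WT := weightE setT measurableT; rewrite partE in WT.
have C_gt0 : (0 < C)%R.
  rewrite lt_def C0 andbT; apply/eqP => CE.
  by move: W0; rewrite WT CE mul0e ltxx.
have Z_gt0 : 0 < ope_partition mu dist n wv.
  by move: W0; rewrite WT pmule_rgt0// lte_fin.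
have Z_fin : ope_partition mu dist n wv \is a fin_num.
  rewrite ge0_fin_numE ?ltW//; move: Woo; rewrite WT.
  case: (ope_partition mu dist n wv) Z_gt0 => [r _ _|_|//]; first exact: ltry.
  by rewrite gt0_muley// lte_fin.
split => //; first by rewrite -ge0_fin_numE// ltW.
move=> E mE.
have cancel (r : R) (a : \bar R) : (0 < r)%R -> (r^-1)%R%:E * (r%:E * a) = a.
  by move=> r0; rewrite muleA -EFinM mulVf ?gt_eqF// mul1e.
have := WE E mE; rewrite weightE// WT -muleA.
move=> /(congr1 (fun a => (C^-1)%R%:E * a)); rewrite !cancel// => ->.
rewrite -{2}(fineK Z_fin) cancel//.
by rewrite fine_gt0// Z_gt0 ltey_eq Z_fin.
Qed.

End conditional_ope.

(** * The real line and the unit circle *)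

Section countable_generators.

(** Half-lines with rational end points generate the Borel sets. *)
Lemma countably_generated_real (R : realType) :
  exists G : nat -> set R, @measurable _ R = <<s range G>>.
Proof.
pose dec := @choice.unpickle (rat : countType).
pose G j : set R := if dec j is Some q then `]ratr q, +oo[%classic else set0.
exists G; apply/seteqP; split; last first.
  apply: smallest_sub; first exact: sigma_algebra_measurable.
  by move=> _ [j _ <-]; rewrite /G; case: (dec j).
have -> : @measurable _ R = <<s @RGenOInfty.G R>> := @RGenOInfty.measurableE R.
apply: smallest_sub; first exact: smallest_sigma_algebra.
move=> _ [x ->].
have -> : `]x, +oo[%classic = \bigcup_j
    (if dec j is Some q then (if x <= ratr q then G j else set0) else set0).
  apply/seteqP; split => [y|y [j _]].
    rewrite /= in_itv /= andbT => /rat_in_itvoo[q].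
    rewrite in_itv /= => /andP[xq qy]; exists (choice.pickle q); first by [].
    by rewrite /G /dec choice.pickleK (ltW xq) /= in_itv /= qy.
  rewrite /G; case: (dec j) => [q|//]; case: ifP => // xq.
  by rewrite /= !in_itv /= !andbT; exact: le_lt_trans.
apply: (@bigcupT_measurable _ (g_sigma_algebraType (range G))) => j.
case decj : (dec j) => [q|]; last exact: measurable0.
case: ifP => _; last exact: measurable0.
by apply: sub_sigma_algebra; exists j.
Qed.

Lemma countably_generated_prod d1 d2 (T1 : measurableType d1) (T2 : measurableType d2) :
  (exists G : nat -> set T1, @measurable _ T1 = <<s range G>>) ->
  (exists G : nat -> set T2, @measurable _ T2 = <<s range G>>) ->
  exists G : nat -> set (T1 * T2), @measurable _ (T1 * T2)%type = <<s range G>>.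
Proof.
move=> [G1 G1E] [G2 G2E].
(* Even and odd indices enumerate the preimages under the two projections. *)
pose G j : set (T1 * T2) :=
  if odd j then fst @^-1` G1 j./2 else snd @^-1` G2 j./2.
exists G; apply/seteqP; split; last first.
  apply: smallest_sub; first exact: sigma_algebra_measurable.
  move=> _ [j _ <-]; rewrite /G; case: (odd j).
    rewrite -[X in measurable X]setTI; apply: measurable_fst => //.
    by rewrite G1E; apply: sub_sigma_algebra; exists j./2.
  rewrite -[X in measurable X]setTI; apply: measurable_snd => //.
  by rewrite G2E; apply: sub_sigma_algebra; exists j./2.
apply: smallest_sub; first exact: smallest_sigma_algebra.
rewrite subUset; split.
  rewrite G1E -g_sigma_preimageE.
  apply: smallest_sub; first exact: smallest_sigma_algebra.
  move=> _ [_ [j _ <-] <-]; apply: sub_sigma_algebra; exists (j.*2.+1) => //.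
  by rewrite /G /= odd_double /= uphalf_double setTI.
rewrite G2E -g_sigma_preimageE.
apply: smallest_sub; first exact: smallest_sigma_algebra.
move=> _ [_ [j _ <-] <-]; apply: sub_sigma_algebra; exists (j.*2) => //.
by rewrite /G odd_double doubleK setTI.
Qed.

Lemma countably_generated_circle (R : realType) :
  exists G : nat -> set (circle R), @measurable _ (circle R) = <<s range G>>.
Proof.
have [G GE] := countably_generated_prod (countably_generated_real R)
  (countably_generated_real R).
exists (fun j => @circle_coord R @^-1` G j).
have -> : @measurable _ (circle R) =
    preimage_set_system setT (@circle_coord R) (@measurable _ (R * R)%type) by [].
rewrite GE -g_sigma_preimageE; congr (<<s _ >>).
apply/seteqP; split => [_ [_ [j _ <-] <-]|_ [j _ <-]].
  by exists j => //; rewrite setTI.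
by exists (G j) => //; rewrite setTI.
Qed.

End countable_generators.

Section line.
Variable R : realType.

Lemma line_dist_sym (x y : R) : line_dist x y = line_dist y x.
Proof. exact: distrC. Qed.

Lemma line_dist_eq0 (x y : R) : line_dist x y = 0 <-> x = y.
Proof.
split => [/eqP|->]; last by rewrite /line_dist subrr normr0.
by rewrite normr_eq0 subr_eq0 => /eqP.
Qed.

Lemma measurable_line_dist :
  measurable_fun setT (fun p : R * R => line_dist p.1 p.2).
Proof. by apply: measurableT_comp => //; apply: measurable_funB. Qed.

Lemma line_weight_damp (w b : R -> R) : measurable_fun setT b ->
  (forall x, 0 <= b x <= 1) -> line_weight w -> line_weight (fun x => b x * w x).
Proof.
move=> mb b01 [mw w0 wint]; split.
- exact: measurable_funM.
- by move=> x; rewrite mulr_ge0//; case/andP: (b01 x).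
- move=> k; apply: le_integrable (wint k) => //.
    apply/measurable_EFinP; apply: measurable_funM; last exact: measurable_funM.
    exact: exprn_measurable.
  move=> x _; rewrite !abse_EFin lee_fin !normrM ler_wpM2l// ler_piMl//.
  by have /andP[b0 b1] := b01 x; rewrite ger0_norm.
Qed.

(** Multiplying a weight by [(x - y)^2] combines three of its moments. *)
Lemma line_weight_repel (w : R -> R) (y : R) : line_weight w ->
  line_weight (fun x => w x * line_dist x y ^+ 2).
Proof.
move=> [mw w0 wint]; split.
- apply: measurable_funM => //; apply: measurable_funX.
  exact: (measurableT_comp measurable_line_dist (pair2_measurable y)).
- by move=> x; rewrite mulr_ge0// sqr_ge0.
- move=> k; have -> : (fun x => (x ^+ k * (w x * line_dist x y ^+ 2))%:E) =
    (((fun x => (x ^+ k.+2 * w x)%:E) \+ (fun x => (- 2 * y)%:E * (x ^+ k.+1 * w x)%:E))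
    \+ (fun x => (y ^+ 2)%:E * (x ^+ k * w x)%:E))%E.
    apply/funext => x /=; rewrite /line_dist real_normK ?num_real//.
    by rewrite -!EFinM -!EFinD !exprS; congr EFin; ring.
  apply: integrableD => //; last exact: integrableZl.
  by apply: integrableD => //; exact: integrableZl.
Qed.

Lemma line_weight_cond (w theta : R -> R) (v : seq R) : measurable_fun setT theta ->
  (forall x, 0 <= theta x <= 1) -> line_weight w ->
  line_weight (cond_weight (@line_dist R) w theta v).
Proof.
move=> mtheta theta01 ww; rewrite /cond_weight; elim: v => [|y v IH].
  under eq_fun do rewrite big_nil mulr1.
  apply: line_weight_damp => //; first exact: measurable_funB.
  by move=> x; have /andP[t0 t1] := theta01 x; apply/andP; split; lra.
under eq_fun do rewrite big_cons (mulrC (line_dist _ _ ^+ 2)) mulrA.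
exact: line_weight_repel.
Qed.

End line.

Section unit_circle.
Variable R : realType.

Lemma circle_coordP (x : circle R) :
  (circle_coord x).1 ^+ 2 + (circle_coord x).2 ^+ 2 = 1.
Proof.
case: x => -[a b] /= /eqP nab; rewrite /circle_coord /=.
by rewrite -(sqr_sqrtr (addr_ge0 (sqr_ge0 a) (sqr_ge0 b))) nab expr1n.
Qed.

Lemma circle_distE (x y : circle R) : circle_dist x y =
  Num.sqrt (((circle_coord x).1 - (circle_coord y).1) ^+ 2 +
            ((circle_coord x).2 - (circle_coord y).2) ^+ 2).
Proof. by case: x => -[a b] ?; case: y => -[c e] ?. Qed.

Lemma circle_dist_sym (x y : circle R) : circle_dist x y = circle_dist y x.
Proof.
by rewrite !circle_distE; congr Num.sqrt; congr (_ + _); rewrite -sqrrN opprB.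
Qed.

Lemma circle_dist_eq0 (x y : circle R) : circle_dist x y = 0 <-> x = y.
Proof.
split => [|->]; last by rewrite circle_distE !subrr expr0n addr0 sqrtr0.
rewrite /circle_dist => /ComplexField.Normc.eq0_normc /eqP.
by rewrite subr_eq0 => /eqP xy; exact: val_inj.
Qed.

(** By the parallelogram identity |x - y|^2 = 4 - |x + y|^2. *)
Lemma circle_dist_sqr_le4 (x y : circle R) : circle_dist x y ^+ 2 <= 4.
Proof.
rewrite circle_distE sqr_sqrtr ?addr_ge0 ?sqr_ge0//.
have := circle_coordP x; have := circle_coordP y.
move: (circle_coord x) (circle_coord y) => [a b] [c e] /= ce ab.
have := sqr_ge0 (a + c); have := sqr_ge0 (b + e).
rewrite !expr2 in ce ab *; nra.
Qed.

Lemma measurable_circle_coord : measurable_fun setT (@circle_coord R).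
Proof. by move=> _ A mA; exists A. Qed.

Lemma measurable_circle_dist :
  measurable_fun setT (fun p : circle R * circle R => circle_dist p.1 p.2).
Proof.
under eq_fun do rewrite circle_distE.
have m1 : measurable_fun setT (fun z : circle R => (circle_coord z).1).
  exact: (measurableT_comp measurable_fst measurable_circle_coord).
have m2 : measurable_fun setT (fun z : circle R => (circle_coord z).2).
  exact: (measurableT_comp measurable_snd measurable_circle_coord).
apply: (measurableT_comp (continuous_measurable_fun (@sqrt_continuous R))).
apply: measurable_funD; apply: measurable_funX; apply: measurable_funB.
- exact: (measurableT_comp m1 measurable_fst).
- exact: (measurableT_comp m1 measurable_snd).
- exact: (measurableT_comp m2 measurable_fst).
- exact: (measurableT_comp m2 measurable_snd).
Qed.

Lemma measurable_expi : measurable_fun setT (@expi R).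
Proof.
move=> _ _ [B mB <-]; rewrite setTI setTI.
have mcs : measurable_fun setT (fun t : R => (cos t, sin t)).
  by apply: measurable_fun_pair; 
      apply: continuous_measurable_fun; [exact: continuous_cos|exact: continuous_sin].
by have := mcs measurableT B mB; rewrite setTI.
Qed.

Lemma arc_measure_sigma_finite :
  exists M : {sigma_finite_measure set (circle R) -> \bar R},
  (M : set (circle R) -> \bar R) = @arc_measure R.
Proof.
pose m0 : {measure set (circle R) -> \bar R} :=
  measure_function_pushforward__canonical__measure_function_Measure
    (mrestr lebesgue_measure (measurable_itv `[0, (2 * pi : R)[)) measurable_expi.
have sfin : sigma_finite setT m0.
  exists (fun=> setT); first by rewrite bigcup_const.
  move=> _; split => //; rewrite /m0 /= /pushforward preimage_setT /mrestr setTI.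
  by rewrite lebesgue_measure_itv /=; case: ifP => _; rewrite -?EFinB ltry.
pose H2 := isSFinite.Build _ _ _ _ (@sfinite_measure_sigma_finite _ _ _ m0 sfin).
pose H3 := isSigmaFinite.Build _ _ _ (Measure.sort m0) sfin.
by exists (HB.pack_for (SigmaFiniteMeasure.type (circle R) R) (Measure.sort m0) H2 H3).
Qed.

Lemma circle_weight_bounded (w b : circle R -> R) C : measurable_fun setT b ->
  (forall x, 0 <= b x <= C) -> circle_weight w -> circle_weight (fun x => b x * w x).
Proof.
move=> mb bC [mw w0 wint]; split.
- exact: measurable_funM.
- by move=> x; rewrite mulr_ge0//; case/andP: (bC x).
- apply: le_integrable (integrableZl _ C wint) => //.
    apply/measurable_EFinP; apply: measurable_funTS.
    exact: (measurableT_comp (measurable_funM mb mw) measurable_expi).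
  move=> x _; rewrite -EFinM !abse_EFin lee_fin.
  have /andP[b0 b1] := bC (expi x); have wx := w0 (expi x).
  by rewrite !ger0_norm ?ler_wpM2r ?mulr_ge0//; exact: le_trans b1.
Qed.

Lemma circle_weight_cond (w theta : circle R -> R) (v : seq (circle R)) :
  measurable_fun setT theta -> (forall x, 0 <= theta x <= 1) -> circle_weight w ->
  circle_weight (cond_weight (@circle_dist R) w theta v).
Proof.
move=> mtheta theta01 ww; rewrite /cond_weight; elim: v => [|y v IH].
  under eq_fun do rewrite big_nil mulr1.
  apply: (@circle_weight_bounded _ _ 1) => //; first exact: measurable_funB.
  by move=> x; have /andP[t0 t1] := theta01 x; apply/andP; split; lra.
under eq_fun do rewrite big_cons mulrCA.
apply: (@circle_weight_bounded _ _ 4) => //.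
  apply: measurable_funX.
  exact: (measurableT_comp measurable_circle_dist (pair2_measurable y)).
by move=> x; rewrite sqr_ge0 circle_dist_sqr_le4.
Qed.

End unit_circle.

Section change_of_space.
Context d1 d2 (T1 : measurableType d1) (T2 : measurableType d2) (R : realType).
Variables (mu : {measure set T1 -> \bar R}) (phi : T1 -> T2).
Hypothesis mphi : measurable_fun setT phi.
Variable M : {sigma_finite_measure set T2 -> \bar R}.
Hypothesis ME : forall A, M A = mu (phi @^-1` A).
Local Open Scope ereal_scope.

Lemma tuple_integral_pushforward n (f : n.-tuple T2 -> \bar R) :
  measurable_fun setT f -> (forall x, 0 <= f x) ->
  tuple_integral M f = tuple_integral mu (fun t => f (map_tuple phi t)).
Proof.
elim: n f => [|n IH] f mf f0 /=.
  by congr f; apply/val_inj.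
have mcons : measurable_fun setT (fun p : T2 * n.-tuple T2 => f [tuple of p.1 :: p.2]).
  by apply: (measurableT_comp mf); exact: measurable_cons.
have mfx x : measurable_fun setT (fun t : n.-tuple T2 => f [tuple of x :: t]).
  exact: (measurableT_comp mcons (pair1_measurable x)).
pose g x := tuple_integral M (fun t : n.-tuple T2 => f [tuple of x :: t]).
have gE x : g x = \int[tuple_measure M n]_t f [tuple of x :: t].
  by rewrite /g tuple_integralE.
have mg : measurable_fun setT g.
  rewrite (funext gE); exact: (measurable_fun_fubini_tonelli_F _ mcons).
have g0 x : 0 <= g x by rewrite gE integral_ge0.
transitivity (\int[pushforward mu phi]_x g x).
  by apply: eq_measure_integral => A mA _; exact: ME.
rewrite ge0_integral_pushforward// preimage_setT; apply: eq_integral => x _ /=.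
rewrite /g IH//; congr tuple_integral; apply/funext => t; congr f.
exact/val_inj.
Qed.

End change_of_space.

Section lebesgue_on_the_line.
Variable R : realType.

(** Lebesgue measure is carried by a copy of the reals with its own structure of
    measurable space; the identity map transports it to the reals. *)
Lemma lebesgue_on_reals : exists M : {sigma_finite_measure set R -> \bar R},
  forall A, M A = @lebesgue_measure R A.
Proof.
have mid : measurable_fun (setT : set (measurableTypeR R))
    (idfun : measurableTypeR R -> R).
  by move=> _ A mA; rewrite setTI.
pose m0 : {measure set R -> \bar R} :=
  measure_function_pushforward__canonical__measure_function_Measure
    (@lebesgue_measure R) mid.
have sfin : sigma_finite setT m0.
  have [F TF mF] := sigma_finiteT (@lebesgue_measure R).
  by exists F => // i; exact: mF.
pose H2 := isSFinite.Build _ _ _ _ (@sfinite_measure_sigma_finite _ _ _ m0 sfin).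
pose H3 := isSigmaFinite.Build _ _ _ (Measure.sort m0) sfin.
by exists (HB.pack_for (SigmaFiniteMeasure.type R R) (Measure.sort m0) H2 H3).
Qed.

Lemma ope_law_lebesgue (M : {sigma_finite_measure set R -> \bar R}) n (w : R -> R)
    (P : set (conf R) -> \bar R) :
  (forall A, M A = @lebesgue_measure R A) ->
  measurable_fun setT w -> (forall x, 0 <= w x) ->
  ope_law M (@line_dist R) n w P <-> ope_law lebesgue_measure (@line_dist R) n w P.
Proof.
move=> ME mw w0.
have mid : measurable_fun (setT : set (measurableTypeR R))
    (idfun : measurableTypeR R -> R).
  by move=> _ A mA; rewrite setTI.
have tupleE (f : n.-tuple R -> \bar R) : measurable_fun setT f ->
    (forall x, 0 <= f x)%E -> tuple_integral M f = tuple_integral lebesgue_measure f.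
  move=> mf f0; rewrite (tuple_integral_pushforward mid ME)//.
  congr tuple_integral; apply/funext => t; congr f.
  by apply/val_inj; rewrite /= map_id.
have md := measurable_ope_density (n := n) (@measurable_line_dist R) mw.
have d0 (x : n.-tuple R) : 0 <= ope_density (@line_dist R) w x.
  exact: ope_density_ge0.
have partE : ope_partition M (@line_dist R) n w =
    ope_partition lebesgue_measure (@line_dist R) n w.
  by apply: tupleE; [exact/measurable_EFinP|move=> x; rewrite lee_fin].
have eventE (E : set (conf R)) : measurable E ->
    tuple_integral M (fun x : n.-tuple R =>
      (ope_density (@line_dist R) w x * \1_E (seq_mset x : conf R))%:E) =
    tuple_integral lebesgue_measure (fun x : n.-tuple R =>
      (ope_density (@line_dist R) w x * \1_E (seq_mset x : conf R))%:E).
  move=> mE; apply: tupleE; last by move=> x; rewrite lee_fin mulr_ge0.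
  apply/measurable_EFinP; apply: measurable_funM => //.
  exact: (measurableT_comp (measurable_indic mE) (@measurable_seq_mset _ R n)).
split=> -[Z0 Zoo PE]; split.
- by rewrite -partE.
- by rewrite -partE.
- by move=> E mE; rewrite -partE -eventE//; exact: PE.
- by rewrite partE.
- by rewrite partE.
- by move=> E mE; rewrite partE eventE//; exact: PE.
Qed.

End lebesgue_on_the_line.

Theorem proposition4p1 (R : realType) (N : nat) (hN : (0 < N)%N) :
  (forall (w theta : R -> R) (P : probability (conf R) R)
      (Ptheta : probability (conf (R * bool)%type) R)
      (m : nat) (nu : {sigma_finite_measure set (R * bool)%type -> \bar R})
      (rho : m.-tuple (R * bool)%type -> R)
      (palm : R.-pker (m.-tuple (R * bool)%type) ~> conf (R * bool)%type),
    measurable_fun setT theta -> (forall x, 0 <= theta x <= 1) ->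
    line_ope N w P -> is_marking theta P Ptheta ->
    (0 < Ptheta (num_marked1 m))%E ->
    is_reduced_palm (cond_num_marked1 Ptheta m) nu rho palm ->
    (0 < N - m)%N ->
    {ae pushforward (cond_num_marked1 Ptheta m) (points_of_mark true),
      forall xi1 : conf R, forall v : m.-tuple R, seq_mset v = xi1 ->
      line_ope (N - m) (cond_weight (@line_dist R) w theta v)
        (cond_ensemble palm v)}) /\
  (forall (w theta : circle R -> R) (P : probability (conf (circle R)) R)
      (Ptheta : probability (conf (circle R * bool)%type) R)
      (m : nat)
      (nu : {sigma_finite_measure set (circle R * bool)%type -> \bar R})
      (rho : m.-tuple (circle R * bool)%type -> R)
      (palm : R.-pker (m.-tuple (circle R * bool)%type) ~>
                conf (circle R * bool)%type),
    measurable_fun setT theta -> (forall z, 0 <= theta z <= 1) ->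
    circle_ope N w P -> is_marking theta P Ptheta ->
    (0 < Ptheta (num_marked1 m))%E ->
    is_reduced_palm (cond_num_marked1 Ptheta m) nu rho palm ->
    (0 < N - m)%N ->
    {ae pushforward (cond_num_marked1 Ptheta m) (points_of_mark true),
      forall xi1 : conf (circle R), forall v : m.-tuple (circle R),
      seq_mset v = xi1 ->
      circle_ope (N - m) (cond_weight (@circle_dist R) w theta v)
        (cond_ensemble palm v)}).
Proof.
split.
- move=> w theta P Ptheta m nu rho palm mtheta theta01 [ww opeP] markP Mgt0 palmP nm.
  have mN : (m <= N)%N by apply: ltnW; rewrite -subn_gt0.
  have [mw w0 _] := ww.
  have [M ME] := lebesgue_on_reals R.
  have opeP' : ope_law M (@line_dist R) (m + (N - m)) w P.
    by rewrite subnKC//; apply/ope_law_lebesgue.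
  have [G GE] := countably_generated_real R.
  have [A [mA A0 sub]] := ope_law_cond_ensemble (@line_dist_sym R)
    (@line_dist_eq0 R) (@measurable_line_dist R) GE mw w0 mtheta theta01 opeP'
    markP Mgt0 palmP.
  exists A; split => //; apply: subset_trans sub; apply: subsetC => xi1 /= good v vxi.
  have wv := line_weight_cond v mtheta theta01 ww.
  split => //; have [mwv wv0 _] := wv.
  by apply/(ope_law_lebesgue _ _ ME) => //; exact: good.
- move=> w theta P Ptheta m nu rho palm mtheta theta01 [ww opeP] markP Mgt0 palmP nm.
  have mN : (m <= N)%N by apply: ltnW; rewrite -subn_gt0.
  have [M ME] := arc_measure_sigma_finite R.
  have opeP' : ope_law M (@circle_dist R) (m + (N - m)) w P.
    by rewrite subnKC// ME.
  have [G GE] := countably_generated_circle R.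
  have [mw w0 _] := ww.
  have [A [mA A0 sub]] := ope_law_cond_ensemble (@circle_dist_sym R)
    (@circle_dist_eq0 R) (@measurable_circle_dist R) GE mw w0 mtheta theta01 opeP'
    markP Mgt0 palmP.
  exists A; split => //; apply: subset_trans sub; apply: subsetC => xi1 /= good v vxi.
  by split; [exact: circle_weight_cond|rewrite -ME; exact: good].
Qed.
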